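(* Let $F:\mathbb{R}^d\to\mathbb{R}$ be a variationally coherent function with minimizer $x^*$. Assume the stochastic gradients satisfy $\mathbb{E}[g_t\mid\mathcal{F}_t]=\nabla F(x_t)$ and $\|g_t\|\le G$ almost surely for all $t\ge1$. Assume the learning rate $\eta_t$ is a non-negative $\mathcal{F}_t$-measurable random variable for each $t\ge1$, and that there is a real number $\gamma>0$ such that, almost surely, $$\sum_{t=1}^\infty \eta_t^2\|g_t\|^2<\gamma,\qquad \sum_{t=1}^\infty \eta_t=+\infty,\qquad \eta_t\le \frac1G\ \text{ for all } t\ge1 .$$ Then the iterates $x_1,x_2,\dots$ of Algorithm 1 (with arbitrary initial point $x_0\in\mathbb{R}^d$) satisfy $\lim_{t\to\infty}x_t=x^*$ almost surely.
   Context: $\|\cdot\|$ is the Euclidean norm on $\mathbb{R}^d$, $G>0$. A function $F:\mathbb{R}^d\to\mathbb{R}$ is variationally coherent if it is continuously differentiable, has a unique minimizer $x^*$, satisfies $\langle\nabla F(x),x-x^*\rangle\ge0$ for all $x\in\mathbb{R}^d$, with equality iff $x=x^*$. Setting: an algorithm outputs iterates $x_1,x_2,\dots$; after outputting $x_t$ it receives a random vector $g_t\in\mathbb{R}^d$ (stochastic gradient). $\mathcal{F}_t$ is the $\sigma$-algebra generated by $x_1,\dots,x_t,g_1,\dots,g_{t-1}$. Auxiliary functions: for $\theta\in\mathbb{R}$, $S>0$, $Q\ge0$, $\psi^*(\theta,S,Q)=\exp\big(\max_{\beta\in[-1/2,1/2]}(\theta\beta-\beta^2S^2)-Q\big)$,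 which equals $\exp(\theta^2/(4S^2)-Q)$ if $|\theta|\le S^2$ and $\exp(|\theta|/2-S^2/4-Q)$ if $|\theta|>S^2$; and $\psi(x,S,Q)=\sup_{\theta\in\mathbb{R}}(\theta x-\psi^*(\theta,S,Q))$. Algorithm 1 (input: $x_0\in\mathbb{R}^d$ and learning rates $\eta_1,\eta_2,\dots$): set $S_0^2=4$, $Q_0=0$, $\theta_0=0\in\mathbb{R}^d$. For $t=1,2,\dots$: output $x_t=x_0+\frac{\theta_{t-1}}{2S_{t-1}^2}\exp\big(\frac{\|\theta_{t-1}\|^2}{4S_{t-1}^2}-Q_{t-1}\big)$ if $\|\theta_{t-1}\|\le S_{t-1}^2$, and $x_t=x_0+\frac{\theta_{t-1}}{2\|\theta_{t-1}\|}\exp\big(\frac{\|\theta_{t-1}\|}{2}-\frac{S_{t-1}^2}{4}-Q_{t-1}\big)$ otherwise (equivalently, $x_t-x_0$ is the unique minimizer of $x\mapsto \psi(\|x\|,S_{t-1},Q_{t-1})-\langle\theta_{t-1},x\rangle$); receive $g_t$; set $\ell_t=\eta_tg_t$, $S_t^2=S_{t-1}^2+\|\ell_t\|^2$ ($S_t>0$), $Q_t=Q_{t-1}+\|\ell_t\|^2/S_t^2$, $\theta_t=\theta_{t-1}-\ell_t$. *)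

(* Defs.v *)
From HB Require Import structures.
From mathcomp Require Import all_boot all_order all_algebra.
From mathcomp Require Import all_classical all_reals all_analysis.
Set Implicit Arguments. Unset Strict Implicit. Unset Printing Implicit Defensive.
Import Order.TTheory GRing.Theory Num.Theory.
Import numFieldNormedType.Exports.
Local Open Scope classical_set_scope.
Local Open Scope ring_scope.

Definition dotv {R : realType} {d : nat} (x y : 'rV[R]_d) : R :=
  \sum_(i < d) x ord0 i * y ord0 i.
Definition enorm {R : realType} {d : nat} (x : 'rV[R]_d) : R :=
  Num.sqrt (dotv x x).

Definition grad {R : realType} {d : nat} (F : 'rV[R]_d -> R) (x : 'rV[R]_d)
  : 'rV[R]_d := \row_(i < d) derive F x (delta_mx ord0 i : 'rV[R]_d).

Definition variationally_coherent {R : realType} {d : nat}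
  (F : 'rV[R]_d -> R) (xstar : 'rV[R]_d) : Prop :=
  [/\ (forall x, differentiable F x),
      continuous (grad F),
      (forall y, F xstar <= F y),
      (forall y, (forall z, F y <= F z) -> y = xstar)
    & (forall x, 0 <= dotv (grad F x) (x - xstar) /\
                 (dotv (grad F x) (x - xstar) = 0 <-> x = xstar))].

Definition alg_out {R : realType} {d : nat} (th : 'rV[R]_d) (S2 Q : R)
  : 'rV[R]_d :=
  if enorm th <= S2 then
    (expR (enorm th ^+ 2 / (4 * S2) - Q) / (2 * S2)) *: th
  else
    (expR (enorm th / 2 - S2 / 4 - Q) / (2 * enorm th)) *: th.

Fixpoint alg_state {R : realType} {d : nat} {T : Type}
  (eta : nat -> T -> R) (g : nat -> T -> 'rV[R]_d) (t : nat) (w : T)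
  : 'rV[R]_d * R * R :=
  match t with
  | 0 => (0, 4, 0)
  | t'.+1 =>
      let: (th, S2, Q) := alg_state eta g t' w in
      let l := eta t'.+1 w *: g t'.+1 w in
      let S2' := S2 + enorm l ^+ 2 in
      (th - l, S2', Q + enorm l ^+ 2 / S2')
  end.

(* iterate x_t (meaningful for t >= 1): x_t = x0 + out(state_{t-1}) *)
Definition xalg {R : realType} {d : nat} {T : Type} (x0 : 'rV[R]_d)
  (eta : nat -> T -> R) (g : nat -> T -> 'rV[R]_d) (t : nat) (w : T)
  : 'rV[R]_d :=
  let: (th, S2, Q) := alg_state eta g t.-1 w in x0 + alg_out th S2 Q.

Definition gen_sets {R : realType} {d : nat} {T : Type} (x0 : 'rV[R]_d)
  (eta : nat -> T -> R) (g : nat -> T -> 'rV[R]_d) (t : nat) : set (set T) :=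
  [set A | exists (i : 'I_d) (B : set R), measurable B /\
     exists s : nat,
       ((1 <= s <= t)%N /\ A = (fun w => xalg x0 eta g s w ord0 i) @^-1` B)
    \/ ((1 <= s < t)%N /\ A = (fun w => g s w ord0 i) @^-1` B)].

Definition filtr {R : realType} {d : nat} {T : Type} (x0 : 'rV[R]_d)
  (eta : nat -> T -> R) (g : nat -> T -> 'rV[R]_d) (t : nat) : set (set T) :=
  <<s gen_sets x0 eta g t >>.

Definition measurable_wrt {R : realType} {T : Type} (Fs : set (set T))
  (f : T -> R) : Prop :=
  forall B : set R, measurable B -> Fs (f @^-1` B).

Definition is_cond_exp {R : realType} {d : nat} {dT : measure_display}
  {T : measurableType dT} (P : probability T R) (Fs : set (set T))
  (X Y : T -> 'rV[R]_d) : Prop :=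
  forall i : 'I_d,
    [/\ P.-integrable setT (fun w => (X w ord0 i)%:E),
        P.-integrable setT (fun w => (Y w ord0 i)%:E),
        measurable_wrt Fs (fun w => Y w ord0 i)
      & forall A, Fs A ->
          (\int[P]_(w in A) (X w ord0 i)%:E = \int[P]_(w in A) (Y w ord0 i)%:E)%E].

(* Main.v *)
(* Write [u = x* - x0] and let [psi(th, S, Q) = exp(phi(th, S) - Q)], where
   [phi(th, S)] is the maximum of [<th, b> - S |b|^2] over the ball [|b| <= 1/2];
   then [x_{t+1} - x0] is the gradient of [psi] at the state [(theta_t, S_t^2, Q_t)].
   The Lyapunov function is [W_t = psi(theta_t, S_t^2, Q_t) - <theta_t, u>]: completing
   the square in the maximisation problem and using [exp(-y - y^2) <= 1 - y] gives
   [W_{t+1} <= W_t - <l_{t+1}, x_{t+1} - x*>] as soon as [|l_{t+1}| <= 1].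
   Taking conditional expectations, [W] is a supermartingale, bounded below because
   [S_t^2] and [Q_t] are, so [W_t] converges almost surely (Doob's upcrossing argument)
   and [sum_t eta_t <grad F(x_t), x_t - x*>] is finite almost surely.  As
   [sum_t eta_t] diverges and [theta_t] stays bounded, [x_t] comes arbitrarily close to
   [x*] infinitely often.  At such times [W_t] is almost the minimum of the convex
   function [psi - <., u>], whose gradient is [x_{t+1} - x*]; as [W] converges, it is
   eventually always almost the minimum, and this function is smooth, so its gradient
   tends to 0. *)
Require Import Defs.
From HB Require Import structures.
From mathcomp Require Import all_boot all_order all_algebra.
From mathcomp Require Import all_classical all_reals all_analysis.
From mathcomp Require Import measurable_realfun ring lra.
Import Order.TTheory GRing.Theory Num.Theory.
Import numFieldNormedType.Exports.
Local Open Scope classical_set_scope.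
Local Open Scope ring_scope.
Set Implicit Arguments.
Unset Strict Implicit.

(** * Inner product and Euclidean norm on row vectors *)

Section euclidean.
Context {R : realType} {d : nat}.
Implicit Types (x y z : 'rV[R]_d) (a : R).

Lemma dotvC x y : dotv x y = dotv y x.
Proof. by apply: eq_bigr => i _; rewrite mulrC. Qed.

Lemma dotvDl x y z : dotv (x + y) z = dotv x z + dotv y z.
Proof. by rewrite -big_split; apply: eq_bigr => i _; rewrite !mxE mulrDl. Qed.

Lemma dotvZl a x y : dotv (a *: x) y = a * dotv x y.
Proof. by rewrite /dotv big_distrr; apply: eq_bigr => i _ /=; rewrite !mxE mulrA. Qed.

Lemma dotvNl x y : dotv (- x) y = - dotv x y.
Proof. by rewrite -scaleN1r dotvZl mulN1r. Qed.

Lemma dotvDr x y z : dotv z (x + y) = dotv z x + dotv z y.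
Proof. by rewrite dotvC dotvDl !(dotvC z). Qed.

Lemma dotvZr a x y : dotv y (a *: x) = a * dotv y x.
Proof. by rewrite dotvC dotvZl dotvC. Qed.

Lemma dotvNr x y : dotv y (- x) = - dotv y x.
Proof. by rewrite dotvC dotvNl dotvC. Qed.

Definition dotvE := (dotvDl, dotvDr, dotvNl, dotvNr, dotvZl, dotvZr).

Lemma dotv_ge0 x : 0 <= dotv x x.
Proof. by apply: sumr_ge0 => i _; rewrite -expr2 sqr_ge0. Qed.

Lemma dotv_eq0 x : dotv x x = 0 -> x = 0.
Proof.
move=> /eqP; rewrite psumr_eq0 => [/allP x0|i _]; last by rewrite -expr2 sqr_ge0.
apply/rowP => i; rewrite mxE; apply/eqP.
by have := x0 i; rewrite mem_index_enum mulf_eq0 orbb; exact.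
Qed.

Lemma sqr_enorm x : enorm x ^+ 2 = dotv x x.
Proof. by rewrite sqr_sqrtr// dotv_ge0. Qed.

Lemma enorm_ge0 x : 0 <= enorm x.
Proof. exact: sqrtr_ge0. Qed.

Lemma enorm_eq0 x : enorm x = 0 -> x = 0.
Proof. by move=> x0; apply: dotv_eq0; rewrite -sqr_enorm x0 expr0n. Qed.

Lemma enorm0 : enorm (0 : 'rV[R]_d) = 0.
Proof. by rewrite /enorm -(scale0r 0) dotvZl mul0r sqrtr0. Qed.

Lemma enormN x : enorm (- x) = enorm x.
Proof. by rewrite /enorm dotvNl dotvNr opprK. Qed.

Lemma enormZ a x : enorm (a *: x) = `|a| * enorm x.
Proof.
by rewrite /enorm dotvZl dotvZr mulrA sqrtrM -?expr2 ?sqr_ge0// sqrtr_sqr.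
Qed.

(** Cauchy-Schwarz: the squared norm of [dotv y y *: x - dotv x y *: y] equals [dotv y y] times the
    difference of the two sides, and this positive factor is cancelled. *)
Lemma sqr_dotv_le x y : dotv x y ^+ 2 <= dotv x x * dotv y y.
Proof.
have [/dotv_eq0 ->|y0] := eqVneq (dotv y y) 0.
  by rewrite -(scale0r 0) !dotvE !(mul0r, mulr0) expr0n.
have yp : 0 < dotv y y by rewrite lt_neqAle eq_sym y0 dotv_ge0.
have := dotv_ge0 (dotv y y *: x - dotv x y *: y).
rewrite !dotvE (dotvC y x) => h.
rewrite -(ler_pM2l yp) -subr_ge0; apply: le_trans h _.
by rewrite le_eqVlt; apply/orP; left; apply/eqP; ring.
Qed.

Lemma normr_dotv_le x y : `|dotv x y| <= enorm x * enorm y.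
Proof.
rewrite -(@ler_pXn2r _ 2)// ?nnegrE ?mulr_ge0 ?enorm_ge0//.
by rewrite exprMn !sqr_enorm real_normK ?num_real// sqr_dotv_le.
Qed.

Lemma dotv_le x y : dotv x y <= enorm x * enorm y.
Proof. exact: le_trans (ler_norm _) (normr_dotv_le _ _). Qed.

Lemma ler_enormD x y : enorm (x + y) <= enorm x + enorm y.
Proof.
rewrite -(@ler_pXn2r _ 2)// ?nnegrE ?addr_ge0 ?enorm_ge0//.
have := dotv_le x y; rewrite sqrrD !sqr_enorm !dotvE (dotvC y x) => h.
lra.
Qed.

Lemma ler_enormB x y : enorm (x - y) <= enorm x + enorm y.
Proof. by rewrite -(enormN y) ler_enormD. Qed.

Lemma normr_coord_le_enorm x i : `|x ord0 i| <= enorm x.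
Proof.
rewrite -(@ler_pXn2r _ 2)// ?nnegrE ?enorm_ge0// sqr_enorm real_normK ?num_real//.
rewrite /dotv (bigD1 i)//= -expr2 lerDl.
by apply: sumr_ge0 => j _; rewrite -expr2 sqr_ge0.
Qed.

End euclidean.

(** * The exponential potential: one-step inequality, convexity and smoothness *)

Section potential.
Context {R : realType} {d : nat}.
Implicit Types (th l b u : 'rV[R]_d) (S Q : R).

(* The maximiser of [dotv th b - S * dotv b b] over the ball [enorm b <= 1/2]. *)
Definition argmax_half th S : 'rV[R]_d :=
  if enorm th <= S then (2 * S)^-1 *: th else (2 * enorm th)^-1 *: th.

Definition max_half th S : R :=
  dotv th (argmax_half th S) - S * dotv (argmax_half th S) (argmax_half th S).

Definition pot th S Q : R := expR (max_half th S - Q).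

Lemma argmax_half_ball th S : 0 < S ->
  dotv (argmax_half th S) (argmax_half th S) <= 4^-1.
Proof.
move=> S0; rewrite /argmax_half; case: ifPn => [thS|]; last rewrite -ltNge => thS.
  rewrite !dotvE -sqr_enorm mulrA -invfM ler_pdivrMl ?mulr_gt0//.
  have := enorm_ge0 th; nra.
have th0 : 0 < enorm th by lra.
rewrite !dotvE -sqr_enorm.
by have -> : (2 * enorm th)^-1 * ((2 * enorm th)^-1 * enorm th ^+ 2) = 4^-1
  by field; lra.
Qed.

(* Strong concavity of the objective gives the quadratic term. *)
Lemma max_half_ge th S b : 0 < S -> dotv b b <= 4^-1 ->
  dotv th b - S * dotv b b <=
  max_half th S - S * dotv (b - argmax_half th S) (b - argmax_half th S).
Proof.
move=> S0 b1; rewrite /max_half.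
(* First-order optimality of the maximiser over the ball. The objective is quadratic, so the rest of
   its expansion is exactly the term [- S * dotv (b - argmax_half th S) (b - argmax_half th S)]. *)
suff : dotv (th - (2 * S) *: argmax_half th S) (b - argmax_half th S) <= 0.
  by rewrite !dotvE (dotvC (argmax_half th S) b) => h; lra.
rewrite /argmax_half; case: ifPn => [thS|]; last rewrite -ltNge => thS.
  rewrite scalerA divff ?scale1r ?subrr -?(scale0r th) ?dotvZl ?mul0r//; lra.
have th0 : 0 < enorm th by lra.
(* When the maximiser lies on the sphere, the gradient of the objective there is a positive multiple
   of [th]; what remains is [dotv th b <= enorm th / 2] on the ball. *)
rewrite scalerA -{1}(scale1r th) -scalerBl dotvZl.
have -> : 1 - 2 * S / (2 * enorm th) = (enorm th - S) / enorm th by field; lra.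
apply: mulr_ge0_le0; first by rewrite divr_ge0//; lra.
rewrite !dotvE -sqr_enorm.
have -> : (2 * enorm th)^-1 * enorm th ^+ 2 = enorm th / 2 by field; lra.
have eb : enorm b <= 2^-1.
  rewrite -(@ler_pXn2r _ 2)// ?nnegrE ?enorm_ge0// sqr_enorm; lra.
have := dotv_le th b; have := enorm_ge0 b; nra.
Qed.

Lemma max_half_ge_ball th S b : 0 < S -> dotv b b <= 4^-1 ->
  dotv th b - S * dotv b b <= max_half th S.
Proof.
move=> S0 b1; apply: le_trans (max_half_ge th _ b1) _ => //.
by rewrite lerBlDr lerDl mulr_ge0 ?dotv_ge0// ltW.
Qed.

(** Unifies both branches of the output into potential times maximiser, which is the gradient of
    [pot] in [th]. *)
Lemma alg_outE th S Q : 0 < S -> alg_out th S Q = pot th S Q *: argmax_half th S.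
Proof.
move=> S0; rewrite /alg_out /pot /max_half /argmax_half.
case: ifPn => [thS|]; last rewrite -ltNge => thS; rewrite scalerA; congr (_ *: _).
  congr (expR _ * _); rewrite !dotvE -sqr_enorm; field; lra.
by congr (expR _ * _); rewrite !dotvE -sqr_enorm; field; lra.
Qed.

(** All terms of the exponential series are nonnegative, so its partial sums increase to the limit;
    three of them are kept. *)
Lemma expR_ge1DxDsqr (x : R) : 0 <= x -> 1 + x + x ^+ 2 / 2 <= expR x.
Proof.
move=> x0.
have nd : nondecreasing_seq (series (exp_coeff x)).
  apply/nondecreasing_seqP => n; rewrite -subr_ge0 /series /= big_nat_recr//=.
  by rewrite addrAC subrr add0r /exp_coeff divr_ge0// exprn_ge0.
have := nondecreasing_cvgn_le nd (is_cvg_series_exp_coeff x) 3.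
rewrite /expR; apply: le_trans.
rewrite /series /= !big_nat_recr//= big_geq// /exp_coeff /=.
by rewrite expr0 expr1 !factS fact0 /= add0r !divr1.
Qed.

(** After inversion the claim reads [1 <= expR (y + y ^+ 2) * (1 - y)]. For negative [y] the
    first-order bound on [expR] suffices; for positive [y] the second-order one is needed, and
    [y <= 2^-1] keeps the remaining factor nonnegative. *)
Lemma expRNsqr_le (y : R) : `|y| <= 2^-1 -> expR (- y - y ^+ 2) <= 1 - y.
Proof.
rewrite ler_norml => /andP[y1 y2].
have -> : - y - y ^+ 2 = - (y + y ^+ 2) by ring.
have y3 : 0 < 1 - y by lra.
rewrite expRN -(ler_pM2l (expR_gt0 (y + y ^+ 2))) divff ?gt_eqF ?expR_gt0//.
have [y0|/ltW y0] := leP 0 y.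
  have e2 := @expR_ge1DxDsqr (y + y ^+ 2) (addr_ge0 y0 (sqr_ge0 y)).
  apply: le_trans (ler_wpM2r (ltW y3) e2).
  have -> : (1 + (y + y ^+ 2) + (y + y ^+ 2) ^+ 2 / 2) * (1 - y) =
    1 + y ^+ 2 / 2 * (1 - y - y ^+ 2 - y ^+ 3) by field.
  rewrite lerDl mulr_ge0 ?divr_ge0 ?sqr_ge0//; nra.
have e1 := expR_ge1Dx (y + y ^+ 2).
apply: le_trans (ler_wpM2r (ltW y3) e1).
have -> : (1 + (y + y ^+ 2)) * (1 - y) = 1 + (- y) ^+ 3 by ring.
by rewrite lerDl exprn_ge0//; lra.
Qed.

Lemma pot_gt0 th S Q : 0 < pot th S Q. Proof. exact: expR_gt0. Qed.

Lemma max_half_ge0 th S : 0 < S -> 0 <= max_half th S.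
Proof.
move=> S0; have := @max_half_ge_ball th S 0 S0; rewrite -(scale0r 0) !dotvE !mul0r.
by rewrite mulr0 subr0; apply; lra.
Qed.

Lemma enorm_argmax_half th S : 0 < S -> enorm (argmax_half th S) <= 2^-1.
Proof.
move=> S0; rewrite -(@ler_pXn2r _ 2)// ?nnegrE ?enorm_ge0// sqr_enorm.
by have := argmax_half_ball th S0; lra.
Qed.

Lemma max_half_le th S : 0 < S -> max_half th S <= enorm th / 2.
Proof.
move=> S0; rewrite /max_half.
have h1 := dotv_le th (argmax_half th S).
have h2 := dotv_ge0 (argmax_half th S).
have h3 := enorm_ge0 th; have h4 := enorm_argmax_half th S0.
nra.
Qed.

(** The competitor is the boundary point of the ball in the direction of [th]. This linear growth is
    what makes the Lyapunov function coercive. *)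
Lemma max_half_lb th S : 0 < S -> enorm th / 2 - S / 4 <= max_half th S.
Proof.
move=> S0; have [/enorm_eq0 ->|th0] := eqVneq (enorm th) 0.
  by rewrite enorm0; have := @max_half_ge0 0 S S0; lra.
have th1 : 0 < enorm th by rewrite lt_neqAle eq_sym th0 enorm_ge0.
have := @max_half_ge_ball th S ((2 * enorm th)^-1 *: th) S0.
rewrite !dotvE -sqr_enorm.
have -> : (2 * enorm th)^-1 * ((2 * enorm th)^-1 * enorm th ^+ 2) = 4^-1 by field.
have -> : (2 * enorm th)^-1 * enorm th ^+ 2 = enorm th / 2 by field.
by apply.
Qed.

Lemma pot_le th S Q : 0 < S -> 0 <= Q -> pot th S Q <= expR (enorm th / 2).
Proof. by move=> S0 Q0; rewrite ler_expR; have := max_half_le th S0; lra. Qed.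

(* With [b* := argmax_half th S], the exponent on the left is at most
   [<th - l, b*> - |b*|^2 S' + |l|^2 / S'] by completing the square in [b - b*]. *)
Lemma pot_step th l S Q : 0 < S -> dotv l l <= 1 ->
  pot (th - l) (S + dotv l l) (Q + dotv l l / (S + dotv l l)) <=
  pot th S Q - dotv l (pot th S Q *: argmax_half th S).
Proof.
move=> S0; set a := dotv l l => l1; set S' := S + a; set b := argmax_half th S.
have a0 : 0 <= a by exact: dotv_ge0.
have S'0 : 0 < S' by rewrite /S'; lra.
set b' := argmax_half (th - l) S'.
have bb : dotv b b <= 4^-1 by exact: argmax_half_ball.
have bb0 := dotv_ge0 b.
have lb2 : dotv l b ^+ 2 <= a * dotv b b by exact: sqr_dotv_le.
(* Completing the square in [b' - b] leaves [dotv (l + (2 * a) *: b) (l + (2 * a) *: b) / (4 * S')];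
   the bound turns this into [a / S'], the increment of [Q]. *)
have m1 : dotv (l + (2 * a) *: b) (l + (2 * a) *: b) <= 4 * a.
  have := dotv_ge0 (l - 2 *: b); rewrite !dotvE (dotvC b l) -/a => h.
  have h1 := mulr_ge0 a0 h.
  have h2 : 0 <= a * (1 - a) by rewrite mulr_ge0//; lra.
  have h3 : 0 <= a * (4^-1 - dotv b b) by rewrite mulr_ge0//; lra.
  have h4 := mulr_ge0 h2 bb0.
  lra.
have key : max_half (th - l) S' <=
    max_half th S - dotv l b - a * dotv b b + a / S'.
  rewrite -lerBlDl ler_pdivlMr// mulrC.
  have h1 := dotv_ge0 ((2 * S') *: (b' - b) + (l + (2 * a) *: b)).
  have h2 := max_half_ge th S0 (argmax_half_ball (th - l) S'0).
  have h3 := ler_wpM2l (ltW S'0) h2.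
  move: m1 h1 h3; rewrite [max_half (th - l) S']/max_half -/b -/b'.
  rewrite !dotvE (dotvC b l) (dotvC b' l) (dotvC b b') -/a.
  have -> : max_half th S = dotv th b - S * dotv b b by [].
  rewrite /S'; lra.
rewrite dotvZr -{1}[pot th S Q]mulr1 -mulrBr.
(* The increment of [Q] cancels [a / S'], and Cauchy-Schwarz replaces [a * dotv b b] by the square
   of [dotv l b], the form needed by [expRNsqr_le]. *)
apply: le_trans (_ : pot th S Q * expR (- dotv l b - dotv l b ^+ 2) <= _); last first.
  rewrite ler_pM2l ?pot_gt0// expRNsqr_le//.
  rewrite -(@ler_pXn2r _ 2)// ?nnegrE ?normr_ge0// real_normK ?num_real//; nra.
by rewrite /pot -expRD ler_expR; lra.
Qed.

(** Convexity in [th]: testing the maximum at [th'] with the maximiser of [th] bounds the exponent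
    below by its linearisation, and [expR x >= 1 + x] does the rest. *)
Lemma pot_ge_tangent th th' S Q : 0 < S ->
  pot th S Q + dotv (pot th S Q *: argmax_half th S) (th' - th) <= pot th' S Q.
Proof.
move=> S0; have := max_half_ge_ball th' S0 (argmax_half_ball th S0).
set b := argmax_half th S => h.
rewrite dotvZl -{1}[pot th S Q]mulr1 -mulrDr.
apply: le_trans (_ : pot th S Q * expR (dotv b (th' - th)) <= _).
  by rewrite ler_pM2l ?pot_gt0// expR_ge1Dx.
rewrite /pot -expRD ler_expR; move: h.
by rewrite /max_half -/b !dotvE (dotvC b th') (dotvC b th); lra.
Qed.

Lemma max_half_geS th S S' : 0 < S -> S <= S' ->
  max_half th S - (S' - S) / 4 <= max_half th S'.
Proof.
move=> S0 SS'; have S'0 : 0 < S' by lra.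
have b1 := argmax_half_ball th S0.
have := max_half_ge_ball th S'0 b1; rewrite [max_half th S]/max_half; nra.
Qed.

(** Keeping the old maximiser when [S] grows costs at most a quarter of the increase, since the ball
    has radius one half. *)
Lemma pot_geSQ th S S' Q Q' : 0 < S -> S <= S' ->
  pot th S Q * (1 - ((S' - S) / 4 + (Q' - Q))) <= pot th S' Q'.
Proof.
move=> S0 SS'; have h := max_half_geS th S0 SS'.
apply: le_trans (_ : pot th S Q * expR (- ((S' - S) / 4 + (Q' - Q))) <= _).
  by rewrite ler_pM2l ?pot_gt0// expR_ge1Dx.
by rewrite /pot -expRD ler_expR; lra.
Qed.

(** Smoothness of the potential with [S] and [Q] frozen. It follows from [pot_step] by undoing the
    growth of [S] and [Q] through [pot_geSQ]. *)
Lemma pot_descent th l S Q : 4 <= S -> 0 <= Q -> dotv l l <= 1 ->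
  pot (th - l) S Q <= pot th S Q - dotv l (pot th S Q *: argmax_half th S)
    + 2 * dotv l l * pot th S Q.
Proof.
move=> S4 Q0 l1; have S0 : 0 < S by lra.
have a0 := dotv_ge0 l.
have h1 := pot_step th Q S0 l1.
have SS : S <= S + dotv l l by lra.
have h2 := pot_geSQ (th - l) Q (Q + dotv l l / (S + dotv l l)) S0 SS.
have h3 : dotv l l / (S + dotv l l) <= dotv l l / 4.
  by rewrite ler_wpM2l// lef_pV2 ?posrE; lra.
have y2 := sqr_dotv_le l (argmax_half th S).
have bb := argmax_half_ball th S0.
move: h1; rewrite dotvZr; set y := dotv l (argmax_half th S) in y2 *.
have y1 : - (2^-1) <= y by nra.
have P0 := pot_gt0 th S Q; have P'0 := pot_gt0 (th - l) S Q.
set P := pot th S Q in P0 *; set P' := pot (th - l) S Q in P'0 h2 *.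
set a := dotv l l in l1 a0 h2 h3 y2 *.
move=> h1; have {h1 h2} := le_trans h2 h1.
set D := _ / 4 + _ => h4; have Da : D <= a / 2 by rewrite /D; lra.
have {}h4 : P' * (1 - a / 2) <= P - P * y by apply: le_trans h4; rewrite ler_pM2l//; lra.
(* An a priori bound, from [a <= 1] and [- (2^-1) <= y]; it converts the error [P' * a / 2] into a
   multiple of [P * a]. *)
have P3 : P' <= 3 * P by nra.
nra.
Qed.
End potential.

(** * Measurability with respect to a generated sigma-algebra *)

Section sub_sigma_algebra.
Context {R : realType} {dT : measure_display} {T : measurableType dT}.
Implicit Types (G : set (set T)) (f : T -> R).

Lemma measurable_wrtE G f :
  measurable_wrt <<s G >> f <-> measurable_fun setT (f : g_sigma_algebraType G -> R).
Proof.
split=> [fG _ B mB|fG B mB]; first by rewrite setTI; apply: (fG B mB).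
by have := fG measurableT B mB; rewrite setTI; apply.
Qed.

Lemma measurable_wrtW G f : <<s G >> `<=` measurable ->
  measurable_wrt <<s G >> f -> measurable_fun setT f.
Proof. by move=> GT fG _ B mB; rewrite setTI; apply: GT; exact: fG. Qed.

End sub_sigma_algebra.

(** * Integrals under a probability measure and bounded test functions *)

Section probability_integral.
Context {R : realType} {dT : measure_display} {T : measurableType dT}
  (P : probability T R).
Implicit Types (f g h Z : T -> R).

Lemma ae_eq_Rintegral f g : measurable_fun setT f -> measurable_fun setT g ->
  {ae P, forall w, f w = g w} -> \int[P]_w f w = \int[P]_w g w.
Proof.
move=> mf mg fg; congr fine; apply: ae_eq_integral => //.
- exact/measurable_EFinP.
- exact/measurable_EFinP.
- by apply: filterS fg => w /= ->.
Qed.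

Lemma ae_bounded_integrable f c : measurable_fun setT f ->
  {ae P, forall w, `|f w| <= c} -> P.-integrable setT (EFin \o f).
Proof.
move=> mf fc; apply/integrableP; split; first exact/measurable_EFinP.
apply: (@le_lt_trans _ _ (\int[P]_w (`|c|%:E))%E).
  apply: ae_ge0_le_integral => //.
  - by apply: measurableT_comp => //; exact/measurable_EFinP.
  - by apply: filterS fc => w /= h _; rewrite lee_fin (le_trans h)// ler_norm.
by rewrite integral_cst//= probability_setT mule1 ltry.
Qed.

Lemma ae_bounded_integrableM h Z c : measurable_fun setT h ->
  {ae P, forall w, `|h w| <= c} -> P.-integrable setT (EFin \o Z) ->
  P.-integrable setT (fun w => (h w * Z w)%:E).
Proof.
move=> mh hc iZ; have mZ : measurable_fun setT Z.
  exact/measurable_EFinP/(measurable_int _ iZ).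
apply/integrableP; split.
  by apply/measurable_EFinP; exact: measurable_funM.
apply: (@le_lt_trans _ _ (\int[P]_w (`|c|%:E * `|(Z w)%:E|))%E).
  apply: ae_ge0_le_integral => //.
  - by apply: measurableT_comp => //; apply/measurable_EFinP; exact: measurable_funM.
  - by apply: emeasurable_funM => //; apply: measurableT_comp => //; exact/measurable_EFinP.
  - apply: filterS hc => w /= h1 _; rewrite -EFinM lee_fin normrM ler_wpM2r//.
    by rewrite (le_trans h1)// ler_norm.
rewrite ge0_integralZl//; last first.
  by apply: measurableT_comp => //; exact/measurable_EFinP.
by rewrite lte_mul_pinfty//; case/integrableP : iZ.
Qed.

Lemma integrable_scale k f : P.-integrable setT (EFin \o f) ->
  P.-integrable setT (EFin \o (fun w => k * f w)).
Proof. by move=> /(integrableZl measurableT k). Qed.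

Lemma integrable_add f g : P.-integrable setT (EFin \o f) ->
  P.-integrable setT (EFin \o g) ->
  P.-integrable setT (EFin \o (fun w => f w + g w)).
Proof. by move=> intf intg; have := integrableD measurableT intf intg. Qed.

Lemma integrable_sub f g : P.-integrable setT (EFin \o f) ->
  P.-integrable setT (EFin \o g) ->
  P.-integrable setT (EFin \o (fun w => f w - g w)).
Proof. by move=> intf intg; have := integrableB measurableT intf intg. Qed.

Lemma integrable_bigsum {I : Type} (r : seq I) (f : I -> T -> R) :
  (forall k, P.-integrable setT (EFin \o f k)) ->
  P.-integrable setT (EFin \o (fun w => \sum_(k <- r) f k w)).
Proof.
move=> intf; elim: r => [|i r IH].
  under [X in _ \o X]eq_fun do rewrite big_nil.
  exact: finite_measure_integrable_cst.
under [X in _ \o X]eq_fun do rewrite big_cons.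
exact: integrable_add.
Qed.

Lemma Rintegral_bigsum {I : Type} (r : seq I) (f : I -> T -> R) :
  (forall k, P.-integrable setT (EFin \o f k)) ->
  \int[P]_w (\sum_(k <- r) f k w) = \sum_(k <- r) \int[P]_w f k w.
Proof.
move=> intf; elim: r => [|i r IH].
  rewrite big_nil; under eq_Rintegral do rewrite big_nil.
  by rewrite Rintegral_cst// mul0r.
rewrite big_cons/= -IH.
under eq_Rintegral do rewrite big_cons.
by rewrite RintegralD//; exact: integrable_bigsum.
Qed.

Lemma Rintegral_indic A f : \int[P]_(w in A) f w = \int[P]_w (\1_A w * f w).
Proof.
rewrite Rintegral_mkcond; apply: eq_Rintegral => w _.
by rewrite patchE indicE; case: ifP => _; rewrite ?mul1r ?mul0r.
Qed.

(** Replacing [f] by the pointwise minimum of [f] and [g] changes it on a null set only and makes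
    the comparison hold everywhere. *)
Lemma ae_le_Rintegral f g :
  P.-integrable setT (EFin \o f) -> P.-integrable setT (EFin \o g) ->
  {ae P, forall w, f w <= g w} -> \int[P]_w f w <= \int[P]_w g w.
Proof.
move=> intf intg fg.
have mf : measurable_fun setT f by exact/measurable_EFinP/(measurable_int _ intf).
have mg : measurable_fun setT g by exact/measurable_EFinP/(measurable_int _ intg).
have mm : measurable_fun setT (f \min g) by exact: measurable_minr.
have em : {ae P, forall w, (f \min g) w = f w}.
  by apply: filterS fg => w /= /min_idPl.
rewrite -(ae_eq_Rintegral mm mf em); apply: le_Rintegral => //; last first.
  by move=> w _ /=; rewrite ge_min lexx orbT.
apply: le_integrable (integrableD measurableT (integrable_norm intf) (integrable_norm intg)) => //.
  exact/measurable_EFinP.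
move=> w _ /=; rewrite !lee_fin /= (ger0_norm (addr_ge0 _ _))//.
by rewrite /Num.min; case: ifP => _; rewrite ?lerDl ?lerDr.
Qed.

(* Replacing [h] by [h - c/2 * 1_{h >= c/2}] leaves the integral unchanged. *)
Lemma Rintegral_halving (G : set (set T)) Z n : <<s G >> `<=` measurable ->
  P.-integrable setT (EFin \o Z) ->
  (forall A, <<s G >> A -> \int[P]_(w in A) Z w = 0) ->
  forall (c : R) h, measurable_wrt <<s G >> h -> (forall w, 0 <= h w <= c) ->
  `|\int[P]_w (h w * Z w)| <= c / 2 ^+ n * \int[P]_w `|Z w|.
Proof.
move=> GT iZ Z0; have mZ : measurable_fun setT Z.
  exact/measurable_EFinP/(measurable_int _ iZ).
have ihZ c h : measurable_wrt <<s G >> h -> (forall w, 0 <= h w <= c) ->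
    P.-integrable setT (EFin \o (fun w => h w * Z w)).
  move=> /(measurable_wrtW GT) mh hc.
  apply: (@ae_bounded_integrableM h Z c) => //.
  by apply: aeW => w; have /andP[h0 h1] := hc w; rewrite ger0_norm.
elim: n => [|n IH] c h mh hc.
  rewrite expr0 divr1 -RintegralZl//; last exact: integrable_norm.
  apply: le_trans (le_normr_Rintegral _ _) _ => //; first exact: (ihZ c).
  apply: le_Rintegral => //.
  - exact: integrable_norm (ihZ c _ mh hc).
  - exact/integrable_scale/integrable_norm.
  - by move=> w _; rewrite normrM ler_wpM2r//; have /andP[h0 h1] := hc w; rewrite ger0_norm.
pose A := [set w | c / 2 <= h w].
have GA : <<s G >> A by rewrite /A -preimage_itvcy; apply: mh; exact: measurable_itv.
pose h' w := h w - c / 2 * \1_A w.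
have mh' : measurable_wrt <<s G >> h'.
  apply/measurable_wrtE.
  apply: (@measurable_funB _ (g_sigma_algebraType G) R setT h (fun w => c / 2 * \1_A w)).
    exact/measurable_wrtE.
  apply: (@measurable_funM _ (g_sigma_algebraType G) R setT (cst (c / 2)) \1_A) => //.
have hc' w : 0 <= h' w <= c / 2.
  rewrite /h' indicE; have /andP[h0 h1] := hc w.
  have [/set_mem|] := boolP (w \in A); first by rewrite /A /= => ?; apply/andP; split; lra.
  rewrite notin_setE /A /= => /negP; rewrite -ltNge => ?.
  by apply/andP; split; rewrite /= ?mulr0; lra.
have -> : \int[P]_w (h w * Z w) = \int[P]_w (h' w * Z w).
  transitivity (\int[P]_w (h' w * Z w + c / 2 * (\1_A w * Z w))).
    by apply: eq_Rintegral => w _; rewrite /h'; ring.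
  have iA : P.-integrable setT (EFin \o (fun w => \1_A w * Z w)).
    apply: (ihZ 1); last by move=> w; rewrite indicE ler0n lern1 leq_b1.
    apply/measurable_wrtE; exact: (@measurable_indic _ (g_sigma_algebraType G) R setT A GA).
  rewrite RintegralD//; [|exact: (ihZ (c / 2))|exact: integrable_scale].
  rewrite RintegralZl// [X in _ + _ * X](_ : _ = 0) ?mulr0 ?addr0//.
  by rewrite -Rintegral_indic Z0.
rewrite exprS invfM mulrA; exact: IH.
Qed.

(** Adding [c] to [h] makes it nonnegative and costs only [c] times the integral of [Z], which is
    zero. The halving bound then holds for every [n] and tends to 0. *)
Lemma Rintegral_mul_eq0 (G : set (set T)) Z : <<s G >> `<=` measurable ->
  P.-integrable setT (EFin \o Z) ->
  (forall A, <<s G >> A -> \int[P]_(w in A) Z w = 0) ->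
  forall (c : R) h, measurable_wrt <<s G >> h -> (forall w, `|h w| <= c) ->
  \int[P]_w (h w * Z w) = 0.
Proof.
move=> GT iZ Z0 c h mh hc; have mZ : measurable_fun setT Z.
  exact/measurable_EFinP/(measurable_int _ iZ).
have mhT := measurable_wrtW GT mh.
have ih : P.-integrable setT (EFin \o (fun w => h w * Z w)).
  by apply: (@ae_bounded_integrableM h Z c) => //; apply: aeW.
have icZ : P.-integrable setT (EFin \o (fun w => c * Z w)) by exact: integrable_scale.
have -> : \int[P]_w (h w * Z w) = \int[P]_w ((h w + c) * Z w).
  transitivity (\int[P]_w (h w * Z w + c * Z w)).
    rewrite RintegralD// RintegralZl// [X in _ * X](_ : _ = 0) ?mulr0 ?addr0//.
    by apply: Z0; exact: (@measurableT _ (g_sigma_algebraType G)).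
  by apply: eq_Rintegral => w _; rewrite mulrDl.
have mhc : measurable_wrt <<s G >> (fun w => h w + c).
  apply/measurable_wrtE.
  apply: (@measurable_funD _ (g_sigma_algebraType G) R setT h (cst c)) => //.
  exact/measurable_wrtE.
have hc2 w : 0 <= h w + c <= 2 * c.
  by have := hc w; rewrite ler_norml => /andP[? ?]; apply/andP; split; lra.
apply/eqP; rewrite -normr_eq0 eq_le normr_ge0 andbT.
have lim0 : (fun n => (2 * c) * (2^-1) ^+ n * \int[P]_w `|Z w|) @ \oo --> (0 : R).
  rewrite [X in _ --> X](_ : _ = 2 * c * 0 * \int[P]_w `|Z w|); last by rewrite mulr0 mul0r.
  apply: cvgMl; apply: cvgMr; apply: cvg_expr.
  by rewrite ger0_norm; lra.
rewrite -(cvg_lim _ lim0)//; apply: limr_ge; first by apply: cvgP lim0.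
near=> n; rewrite exprVn; exact: (Rintegral_halving n GT iZ Z0 mhc hc2).
Unshelve. all: by end_near. Qed.

End probability_integral.

(** * Pulling out known factors, and series with bounded expectation *)

Section conditional_expectation.
Context {R : realType} {dT : measure_display} {T : measurableType dT}
  (P : probability T R).
Implicit Types (f h X Y : T -> R).

Lemma cond_exp_pull_out (G : set (set T)) X Y h (c : R) :
  <<s G >> `<=` measurable ->
  P.-integrable setT (EFin \o X) -> P.-integrable setT (EFin \o Y) ->
  (forall A, <<s G >> A -> \int[P]_(w in A) X w = \int[P]_(w in A) Y w) ->
  measurable_wrt <<s G >> h -> {ae P, forall w, `|h w| <= c} ->
  \int[P]_w (h w * X w) = \int[P]_w (h w * Y w).
Proof.
move=> GT iX iY XY mh hc; have mhT := measurable_wrtW GT mh.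
have ihX := ae_bounded_integrableM mhT hc iX.
have ihY := ae_bounded_integrableM mhT hc iY.
apply/eqP; rewrite -subr_eq0 -RintegralB//; apply/eqP.
(* The bound on [h] holds almost surely only. Truncating by a condition on [h] itself preserves
   measurability with respect to the sub-sigma-algebra. *)
pose h' w := if `|h w| <= c then h w else 0.
have mh' : measurable_wrt <<s G >> h'.
  apply/measurable_wrtE.
  apply: (@measurable_fun_ifT _ _ (g_sigma_algebraType G)) => //; last exact/measurable_wrtE.
  apply: (@measurable_fun_ler _ (g_sigma_algebraType G)) => //.
  by apply: measurableT_comp => //; exact/measurable_wrtE.
have h'h : {ae P, forall w, h' w = h w}.
  by apply: filterS hc => w; rewrite /h' => ->.
have iXY := integrable_sub iX iY.
have mXY : measurable_fun setT (fun w => X w - Y w).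
  exact/measurable_EFinP/(measurable_int _ iXY).
have mh'T := measurable_wrtW GT mh'.
transitivity (\int[P]_w (h' w * (X w - Y w))).
  apply: ae_eq_Rintegral.
  - exact/measurable_EFinP/(measurable_int _ (integrable_sub ihX ihY)).
  - exact: measurable_funM.
  - by apply: filterS h'h => w ->; rewrite mulrBr.
apply: (@Rintegral_mul_eq0 _ _ _ P G (fun w => X w - Y w) GT iXY _ `|c|) => //.
  move=> A GA; rewrite RintegralB ?XY ?subrr//; first exact: GT.
    by apply: integrableS iX => //; exact: GT.
  by apply: integrableS iY => //; exact: GT.
move=> w; rewrite /h'; case: ifP => [hw|_]; last by rewrite normr0.
exact: le_trans hw (ler_norm _).
Qed.

(** By monotone convergence the infinite sum has integral at most [K], hence is finite almost
    everywhere and bounds its partial sums. *)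
Lemma ae_bounded_series (f : nat -> T -> R) (K : R) :
  (forall n, P.-integrable setT (EFin \o f n)) -> (forall n w, 0 <= f n w) ->
  (forall n, \sum_(k < n) \int[P]_w f k w <= K) ->
  {ae P, forall w, exists M, forall n, \sum_(k < n) f k w <= M}.
Proof.
move=> intf f0 fK.
have mf n : measurable_fun setT (EFin \o f n) by exact: measurable_int (intf n).
have f0' n w : setT w -> (0 <= (EFin \o f n) w)%E by rewrite lee_fin.
have mS : measurable_fun setT (fun w => \sum_(n <oo) (EFin \o f n) w)%E.
  by apply: ge0_emeasurable_sum => // k w _ _; exact: f0'.
have S0 w : (0 <= \sum_(n <oo) (EFin \o f n) w)%E.
  by apply: nneseries_ge0 => n _ _; exact: f0'.
have iS : P.-integrable setT (fun w => \sum_(n <oo) (EFin \o f n) w)%E.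
  apply/integrableP; split => //.
  under eq_integral do rewrite gee0_abs//.
  rewrite integral_nneseries//.
  apply: (@le_lt_trans _ _ K%:E); last exact: ltry.
  apply: lime_le; first by apply: is_cvg_nneseries => n _ _; apply: integral_ge0 => w; exact: f0'.
  near=> n; rewrite big_mkord.
  rewrite (eq_bigr (fun k : 'I_n => (\int[P]_w f k w)%:E)); last first.
    by move=> k _; rewrite fineK//; exact: (integrable_fin_num measurableT (intf k)).
  rewrite sumEFin lee_fin; exact: fK.
apply: filterS (integrable_ae measurableT iS) => w /(_ I) fin.
exists (fine (\sum_(n <oo) (EFin \o f n) w)%E) => n.
rewrite -lee_fin fineK// -sumEFin.
have := @nneseries_lim_ge R (fun k => (f k w)%:E) xpredT 0%N n (fun k _ _ => f0' k w I).
by rewrite big_mkord; apply.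
Unshelve. all: by end_near. Qed.

End conditional_expectation.

(** * Upcrossings of a real sequence *)

Section upcrossings.
Context {R : realType}.
Implicit Types (a b : R) (x : nat -> R).

(* Buy when [x <= a], sell when [b <= x]; [holding] is the position carried from
   time [n] to time [n.+1], and [upcross] marks the sales. *)
Fixpoint holding a b x n : bool :=
  if n is m.+1 then if holding a b x m then x n < b else x n <= a
  else x 0%N <= a.

Definition upcross a b x n : R := (holding a b x n && (b <= x n.+1))%:R.

Definition gain a b x n : R := if holding a b x n then x n.+1 - x n else 0.

(** Each completed sale earns at least [b - a]; the conditional term is the value of a position
    still open, which may be negative. *)
Lemma upcross_le_gain a b x n :
  (b - a) * \sum_(k < n) upcross a b x k + (if holding a b x n then x n - a else 0)
  <= \sum_(k < n) gain a b x k.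
Proof.
elim: n => [|n IH].
  by rewrite !big_ord0 mulr0 add0r /=; case: ifPn => //; rewrite subr_le0.
rewrite !big_ord_recr /= /upcross /gain mulrDr; move: IH.
set s := \sum_(k < n) _; set s' := \sum_(k < n) _.
case: (holding a b x n) => /=.
  by case: leP => bx /=; rewrite ?mulr1 ?mulr0 => h; lra.
rewrite mulr0 !addr0 => h; case: ifP => ?; lra.
Qed.

(** If both alternatives fail, the sequence is at most [a] and at least [b] infinitely often, which
    forces unboundedly many sales. *)
Lemma upcross_dichotomy a b x M : a < b ->
  (forall n, \sum_(k < n) upcross a b x k <= M) ->
  (exists N, forall n, (N <= n)%N -> a < x n) \/
  (exists N, forall n, (N <= n)%N -> x n < b).
Proof.
move=> ab xM; apply: contrapT => /not_orP[Ha Hb].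
have low N : exists2 n, (N <= n)%N & x n <= a.
  apply: contrapT => h; apply: Ha; exists N => n Nn; rewrite ltNge; apply/negP => xa.
  by apply: h; exists n.
have high N : exists2 n, (N <= n)%N & b <= x n.
  apply: contrapT => h; apply: Hb; exists N => n Nn; rewrite ltNge; apply/negP => xa.
  by apply: h; exists n.
(* Without a sale after a visit below [a] the position would be held forever, yet the next visit
   above [b] is a sale. *)
have up N : exists2 k, (N <= k)%N & upcross a b x k = 1.
  apply: contrapT => h; have [n Nn xn] := low N.
  have hold j : holding a b x (n + j).
    elim: j => [|j IH].
      rewrite addn0; case: n Nn xn => [|n] _ //= xn.
      by case: ifP => // _; lra.
    rewrite addnS /= IH ltNge; apply/negP => bx.
    apply: h; exists (n + j)%N; first exact: leq_trans (leq_addr _ _).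
    by rewrite /upcross IH bx.
  have [m nm bm] := high n.+1.
  apply: h; exists m.-1; first by rewrite (leq_trans Nn)// -ltnS (ltn_predK nm).
  rewrite /upcross (ltn_predK nm) bm andbT.
  by have := hold (m.-1 - n)%N; rewrite subnKC ?(leq_trans _ nm)// => [->//|];
    rewrite -ltnS (ltn_predK nm).
have up0 k : 0 <= upcross a b x k by rewrite ler0n.
have big m : exists n, m%:R <= \sum_(k < n) upcross a b x k.
  elim: m => [|m [n IH]]; first by exists 0%N; rewrite big_ord0.
  have [k nk k1] := up n; exists k.+1.
  rewrite big_ord_recr /= k1 -natr1 lerD2r (le_trans IH)//.
  rewrite -!(big_mkord xpredT (upcross a b x)) [leRHS](@big_cat_nat _ _ _ n)//=.
  by rewrite lerDl sumr_ge0.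
have [n] := big (Num.truncn `|M|).+1.
by rewrite leNgt (le_lt_trans (le_trans (xM n) (ler_norm _))) ?truncnS_gt.
Qed.

(** The limit is the infimum of the eventual upper bounds, that is, the limit superior. Only
    rational levels are assumed, so that countably many almost sure events suffice later. *)
Lemma upcross_cvg x (C L : R) :
  (forall n, C <= x n) -> (forall N, exists2 n, (N <= n)%N & x n <= L) ->
  (forall a b : rat, (a < b)%R -> exists M,
     forall n, \sum_(k < n) upcross (ratr a) (ratr b) x k <= M) ->
  cvgn x.
Proof.
move=> Cx Lx up.
have dich (a b : R) : a < b -> (exists N, forall n, (N <= n)%N -> a < x n) \/
    (exists N, forall n, (N <= n)%N -> x n < b).
  move=> ab; have [q qab] := rat_in_itvoo ab.
  move: qab; rewrite in_itv /= => /andP[aq qb].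
  have [r] := rat_in_itvoo qb; rewrite in_itv /= => /andP[qr rb].
  rewrite ltr_rat in qr; have [M hM] := up _ _ qr.
  have qr' : ratr q < ratr r :> R by rewrite ltr_rat.
  have [[N h]|[N h]] := upcross_dichotomy qr' hM; [left|right]; exists N => n Nn.
    exact: lt_trans aq (h _ Nn).
  exact: lt_trans (h _ Nn) rb.
pose S := [set c : R | exists N, forall n, (N <= n)%N -> x n <= c].
have S0 : S !=set0.
  have [[N h]|[N h]] := dich L (L + 1) (ltr_pwDr ltr01 (lexx L)).
    by have [n Nn] := Lx N; rewrite leNgt h.
  by exists (L + 1), N => n Nn; exact/ltW/h.
have lS : has_lbound S.
  by exists C => c [N h]; exact: le_trans (Cx N) (h _ _).
have infS : has_inf S by split.
apply/cvg_ex; exists (inf S); apply/cvgrPdist_le => /= e e0.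
have [c [N hc] ce] := inf_adherent e0 infS.
(* The second alternative at these levels would produce an eventual upper bound below [inf S]. *)
have e2 : inf S - e < inf S - e / 2 by lra.
have [[N2 h2]|[N2 h2]] := dich _ _ e2.
  exists (maxn N N2) => // n /=; rewrite geq_max => /andP[Nn N'n].
  by have := hc n Nn; have := h2 n N'n; rewrite ler_norml => ? ?; apply/andP; split; lra.
have : inf S <= inf S - e / 2.
  by apply: ge_inf => //; exists N2 => n Nn; exact/ltW/h2.
lra.
Qed.

End upcrossings.

(** * Almost sure convergence of supermartingales bounded below *)

Section supermartingale.
Context {R : realType} {dT : measure_display} {T : measurableType dT}
  (P : probability T R).
Variables (G : nat -> set (set T)) (W : nat -> T -> R) (C : R).
Hypothesis GT : forall n, <<s G n >> `<=` measurable.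
Hypothesis Gmono : forall n, <<s G n >> `<=` <<s G n.+1 >>.
Hypothesis mW : forall n, measurable_wrt <<s G n >> (W n).
Hypothesis intW : forall n, P.-integrable setT (EFin \o W n).
Hypothesis lbW : {ae P, forall w, forall n, - C <= W n w}.
Hypothesis superW : forall n A, <<s G n >> A ->
  \int[P]_(w in A) W n.+1 w <= \int[P]_(w in A) W n w.

Let hold a b n : set T := [set w | holding a b (W ^~ w) n].

(** The strategy is predictable: the position carried from [n] to [n.+1] is decided by the values up
    to time [n]. *)
Lemma holding_sigma a b n : <<s G n >> (hold a b n).
Proof.
have lt n' c : <<s G n' >> [set w | W n' w < c].
  by rewrite -preimage_itvNyo; apply: mW; exact: measurable_itv.
have le n' c : <<s G n' >> [set w | W n' w <= c].
  by rewrite -preimage_itvNyc; apply: mW; exact: measurable_itv.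
elim: n => [|n IH]; first exact: le.
have -> : hold a b n.+1 = (hold a b n `&` [set w | W n.+1 w < b]) `|`
    (~` hold a b n `&` [set w | W n.+1 w <= a]).
  rewrite /hold; apply/seteqP; split => w /=.
    by case: ifPn => h; [left|right; split => //; exact/negP].
  by case=> -[]; [move=> ->|move=> /negP/negbTE ->].
pose T' := g_sigma_algebraType (G n.+1).
apply: (@measurableU _ T'); apply: (@measurableI _ T').
- exact: Gmono.
- exact: lt.
- by apply: (@measurableC _ T'); exact: Gmono.
- exact: le.
Qed.

Let gainE a b n : (fun w => gain a b (W ^~ w) n) =
  (fun w => W n.+1 w - W n w) \_ (hold a b n).
Proof.
apply/funext => w; rewrite patchE /gain /hold.
by case: ifPn => [h|/negP h]; [rewrite mem_set|rewrite memNset].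
Qed.

Lemma integrable_gain a b n : P.-integrable setT (EFin \o (fun w => gain a b (W ^~ w) n)).
Proof.
have mH : measurable (hold a b n) by apply: (@GT n); exact: holding_sigma.
rewrite gainE -restrict_EFin.
have iW : P.-integrable (hold a b n) (EFin \o (fun w => W n.+1 w - W n w)).
  have := integrable_sub (intW n.+1) (intW n).
  exact: integrableS.
by rewrite -integrable_mkcond.
Qed.

Lemma Rintegral_gain_le0 a b n : \int[P]_w gain a b (W ^~ w) n <= 0.
Proof.
have mH : measurable (hold a b n) by apply: (@GT n); exact: holding_sigma.
rewrite gainE -Rintegral_mkcond RintegralB//; first last.
- exact: integrableS (intW _).
- exact: integrableS (intW _).
rewrite subr_le0; apply: superW; exact: holding_sigma.
Qed.

Lemma integrable_upcross a b n :
  P.-integrable setT (EFin \o (fun w => upcross a b (W ^~ w) n)).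
Proof.
have mH : measurable (hold a b n `&` [set w | b <= W n.+1 w]).
  apply: measurableI; first by apply: (@GT n); exact: holding_sigma.
  by rewrite -preimage_itvcy; apply: (@GT n.+1); apply: mW; exact: measurable_itv.
have -> : (fun w => upcross a b (W ^~ w) n) =
    \1_(hold a b n `&` [set w | b <= W n.+1 w]).
  apply/funext => w; rewrite /upcross indicE; congr ((nat_of_bool _)%:R); apply/idP/idP.
    by move=> /andP[h1 h2]; rewrite inE.
  by rewrite inE => -[/= -> ->].
by apply: integrable_indic => //; rewrite (le_lt_trans (probability_le1 _ _))// ltry.
Qed.

(** Integrate [upcross_le_gain]: expected gains are nonpositive and an open position loses at most
    the sum of the absolute values of [C] and [a], which bounds the expected number of sales. *)
Lemma upcross_bounded a b : a < b ->
  {ae P, forall w, exists M, forall n, \sum_(k < n) upcross a b (W ^~ w) k <= M}.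
Proof.
move=> ab; apply: (@ae_bounded_series _ _ _ P (fun n w => upcross a b (W ^~ w) n)
  ((`|C| + `|a|) / (b - a))).
- exact: integrable_upcross.
- by move=> n w; rewrite ler0n.
move=> n; have ba : 0 < b - a by lra.
have isup := integrable_bigsum (index_enum 'I_n) (fun k : 'I_n => integrable_upcross a b k).
have isgain := integrable_bigsum (index_enum 'I_n) (fun k : 'I_n => integrable_gain a b k).
rewrite ler_pdivlMr// mulrC.
rewrite -(Rintegral_bigsum _ (fun k : 'I_n => integrable_upcross a b k)).
rewrite -RintegralZl//.
apply: (@le_trans _ _ (\int[P]_w (\sum_(k < n) gain a b (W ^~ w) k + (`|C| + `|a|)))).
  apply: ae_le_Rintegral.
  - exact: integrable_scale.
  - apply: integrable_add; first exact: isgain.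
    exact: finite_measure_integrable_cst.
  - apply: filterS lbW => w CW.
    have := upcross_le_gain a b (W ^~ w) n; have := CW n.
    have := ler_norm C; have := ler_norm a; have := normr_ge0 C; have := normr_ge0 a.
    by case: ifP => _ *; lra.
rewrite RintegralD//; last exact: finite_measure_integrable_cst.
rewrite Rintegral_cst//= probability_setT mulr1 gerDr.
rewrite (Rintegral_bigsum _ (fun k : 'I_n => integrable_gain a b k)).
by apply: sumr_le0 => k _; exact: Rintegral_gain_le0.
Qed.

Lemma Rintegral_supermartingale n : \int[P]_w W n w <= \int[P]_w W 0 w.
Proof.
elim: n => // n; apply: le_trans; apply: superW.
exact: (@measurableT _ (g_sigma_algebraType (G n))).
Qed.

(** Excludes divergence to infinity. The first moments of the absolute values are bounded, so by
    Fatou their lower limit is integrable, hence finite almost surely. *)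
Lemma supermartingale_frequently_bounded :
  {ae P, forall w, exists L, forall N, exists2 n, (N <= n)%N & W n w <= L}.
Proof.
(* For [x >= - C] the absolute value of [x] is at most [x] plus twice that of [C]. *)
pose K := \int[P]_w W 0 w + 2 * `|C|.
have mWT n : measurable_fun setT (W n) by exact: (measurable_wrtW (@GT n) (@mW n)).
have mf n : measurable_fun setT (fun w => `|W n w|%:E).
  by apply/measurable_EFinP; exact: measurableT_comp.
have EK n : (\int[P]_w `|W n w|%:E <= K%:E)%E.
  have iN := integrable_norm (intW n).
  rewrite -[leLHS]fineK; last exact: (integrable_fin_num _ iN).
  rewrite lee_fin; apply: (@le_trans _ _ (\int[P]_w (W n w + 2 * `|C|))).
    apply: ae_le_Rintegral => //.
      by apply: integrable_add => //; exact: finite_measure_integrable_cst.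
    apply: filterS lbW => w /(_ n) h; have := ler_norm C; have := normr_ge0 C.
    by case: (ger0P (W n w)) => *; lra.
  rewrite RintegralD//; last exact: finite_measure_integrable_cst.
  by rewrite Rintegral_cst//= probability_setT mulr1 lerD2r Rintegral_supermartingale.
have f0 n w : setT w -> (0 <= `|W n w|%:E)%E by rewrite lee_fin.
have liK : (\int[P]_w limn_einf (fun n => `|W n w|%:E) <= K%:E)%E.
  apply: le_trans (fatou P measurableT mf f0) _.
  rewrite limn_einf_lim; apply: lime_le; first exact: is_cvg_einfs.
  near=> n; apply: le_trans (EK n); apply: ereal_inf_lbound; exists n => //=.
have li0 w : (0 <= limn_einf (fun n => `|W n w|%:E))%E.
  rewrite limn_einf_lim; apply: lime_ge; first exact: is_cvg_einfs.
  by near=> n; apply: le_ereal_inf_tmp => _ [k _ <-]; exact: f0.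
have ili : P.-integrable setT (fun w => limn_einf (fun n => `|W n w|%:E)).
  apply/integrableP; split.
    rewrite /limn_einf; apply: measurableT_comp => //.
    by apply: measurable_fun_limn_esup => n; exact: measurableT_comp.
  under eq_integral do rewrite gee0_abs//.
  by rewrite (le_lt_trans liK)// ltry.
apply: filterS (integrable_ae measurableT ili) => w /(_ I) fin.
apply: contrapT => h; move: fin; suff -> : limn_einf (fun n => `|W n w|%:E) = +oo%E by [].
apply: (cvg_limn_einf_sup _).1; apply/cvgeyPge => A.
have [N hN] : exists N, forall n, (N <= n)%N -> A < W n w.
  apply: contrapT => hN; apply: h; exists A => N; apply: contrapT => h.
  apply: hN; exists N => n Nn; rewrite ltNge; apply/negP => WA.
  by apply: h; exists n.
exists N => // n /= Nn; rewrite lee_fin (le_trans (ltW (hN n Nn)))// ler_norm.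
Unshelve. all: by end_near. Qed.

Theorem supermartingale_cvg : {ae P, forall w, cvgn (W ^~ w)}.
Proof.
have up : {ae P, forall w, forall a b : rat, a < b -> exists M,
    forall n, \sum_(k < n) upcross (ratr a) (ratr b) (W ^~ w) k <= M}.
  (* Pairs of rationals are enumerated by [unpickle] so that countably many null sets can be
     merged. *)
  suff : {ae P, forall w, forall k, if @unpickle (rat * rat)%type k is Some (a, b) then
      a < b -> exists M, forall n, \sum_(k < n) upcross (ratr a) (ratr b) (W ^~ w) k <= M
      else True}.
    by apply: filterS => w h a b; have := h (pickle (a, b)); rewrite pickleK.
  apply: ae_foralln => k; case: unpickle => [[a b]|]; last exact: aeW.
  have [ab|nab] := boolP (a < b); last by apply: aeW.
  have ab' : ratr a < ratr b :> R by rewrite ltr_rat.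
  by apply: filterS (upcross_bounded ab') => w h _.
apply: filterS3 lbW supermartingale_frequently_bounded up => w CW [L WL] up.
exact: upcross_cvg CW WL up.
Qed.
End supermartingale.

(** * Coordinatewise measurability of vector-valued maps *)

Section vector_measurability.
Context {R : realType} {d : nat} {dT : measure_display} {T : measurableType dT}.
Implicit Types (v u : T -> 'rV[R]_d) (f : T -> R).

Definition vmeasurable v := forall i, measurable_fun setT (fun w => v w ord0 i).

Lemma vmeasurable_cst (x : 'rV[R]_d) : vmeasurable (fun=> x).
Proof. by move=> i. Qed.

Lemma vmeasurableD v u : vmeasurable v -> vmeasurable u ->
  vmeasurable (fun w => v w + u w).
Proof.
move=> mv mu i; under eq_fun do rewrite mxE.
exact: measurable_funD.
Qed.

Lemma vmeasurableZ f v : measurable_fun setT f -> vmeasurable v ->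
  vmeasurable (fun w => f w *: v w).
Proof.
move=> mf mv i; under eq_fun do rewrite mxE.
exact: measurable_funM.
Qed.

Lemma vmeasurableB v u : vmeasurable v -> vmeasurable u ->
  vmeasurable (fun w => v w - u w).
Proof.
move=> mv mu i; under eq_fun do rewrite !mxE.
exact: measurable_funB.
Qed.

Lemma measurable_dotv v u : vmeasurable v -> vmeasurable u ->
  measurable_fun setT (fun w => dotv (v w) (u w)).
Proof. by move=> mv mu; apply: measurable_sum => i; exact: measurable_funM. Qed.

Lemma measurable_enorm v : vmeasurable v -> measurable_fun setT (fun w => enorm (v w)).
Proof.
move=> mv; have msqrt : measurable_fun setT (@Num.sqrt R).
  by apply: nondecreasing_measurable => //; exact: ler_wsqrtr.
exact: (measurableT_comp msqrt (measurable_dotv mv mv)).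
Qed.

Lemma measurable_inv_ge0 f : measurable_fun setT f -> (forall w, 0 <= f w) ->
  measurable_fun setT (fun w => (f w)^-1).
Proof.
move=> mf f0; under eq_fun do rewrite -powR_inv1//.
exact: (measurableT_comp (measurable_powR (-1)) mf).
Qed.

Lemma vmeasurable_argmax_half v f : vmeasurable v -> measurable_fun setT f ->
  (forall w, 0 < f w) -> vmeasurable (fun w => argmax_half (v w) (f w)).
Proof.
move=> mv mf f0 i.
have -> : (fun w => argmax_half (v w) (f w) ord0 i) =
    (fun w => (if enorm (v w) <= f w then (2 * f w)^-1 else (2 * enorm (v w))^-1) *
      v w ord0 i).
  by apply/funext => w; rewrite /argmax_half; case: ifP; rewrite mxE.
apply: measurable_funM => //; apply: measurable_fun_ifT.
- by apply: measurable_fun_ler => //; exact: measurable_enorm.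
- apply: measurable_inv_ge0 => [|w]; last by rewrite mulr_ge0// ltW.
  exact: measurable_funM.
- apply: measurable_inv_ge0 => [|w]; last by rewrite mulr_ge0// enorm_ge0.
  by apply: measurable_funM => //; exact: measurable_enorm.
Qed.

Lemma measurable_pot v f h : vmeasurable v -> measurable_fun setT f ->
  measurable_fun setT h -> (forall w, 0 < f w) ->
  measurable_fun setT (fun w => pot (v w) (f w) (h w)).
Proof.
move=> mv mf mh f0; apply: measurableT_comp; first exact: measurable_expR.
have mb := vmeasurable_argmax_half mv mf f0.
apply: measurable_funB => //; apply: measurable_funB; first exact: measurable_dotv.
by apply: measurable_funM => //; exact: measurable_dotv.
Qed.

Lemma vmeasurable_alg_out v f h : vmeasurable v -> measurable_fun setT f ->
  measurable_fun setT h -> (forall w, 0 < f w) ->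
  vmeasurable (fun w => alg_out (v w) (f w) (h w)).
Proof.
move=> mv mf mh f0; under eq_fun do rewrite alg_outE//.
by apply: vmeasurableZ; [exact: measurable_pot|exact: vmeasurable_argmax_half].
Qed.

End vector_measurability.

(** * Recursion for the state of the algorithm *)

Section state.
Context {R : realType} {d : nat} {T : Type}.
Variables (eta : nat -> T -> R) (g : nat -> T -> 'rV[R]_d).

Definition theta t w : 'rV[R]_d := (alg_state eta g t w).1.1.
Definition S2 t w : R := (alg_state eta g t w).1.2.
Definition Qs t w : R := (alg_state eta g t w).2.
(** The increment from state [t] to state [t.+1], hence the scaled gradient of index [t.+1]. *)
Definition step t w : 'rV[R]_d := eta t.+1 w *: g t.+1 w.

Lemma thetaS t w : theta t.+1 w = theta t w - step t w.
Proof. by rewrite /theta /=; case: alg_state => -[]. Qed.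

Lemma S2S t w : S2 t.+1 w = S2 t w + dotv (step t w) (step t w).
Proof. by rewrite /S2 /= -sqr_enorm; case: alg_state => -[]. Qed.

Lemma QsS t w : Qs t.+1 w = Qs t w + dotv (step t w) (step t w) / S2 t.+1 w.
Proof. by rewrite S2S /Qs /S2 /= -sqr_enorm; case: alg_state => -[]. Qed.

Lemma S2_ge4 t w : 4 <= S2 t w.
Proof. by elim: t => [//|t IH]; rewrite S2S; have := dotv_ge0 (step t w); lra. Qed.

Lemma S2_gt0 t w : 0 < S2 t w.
Proof. by have := S2_ge4 t w; lra. Qed.

Lemma Qs_ge0 t w : 0 <= Qs t w.
Proof.
by elim: t => [//|t IH]; rewrite QsS addr_ge0// divr_ge0 ?dotv_ge0// ltW ?S2_gt0.
Qed.

Lemma S2_le t w : S2 t w <= S2 t.+1 w.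
Proof. by rewrite S2S lerDl dotv_ge0. Qed.

Lemma Qs_le t w : Qs t w <= Qs t.+1 w.
Proof. by rewrite QsS lerDl divr_ge0 ?dotv_ge0// ltW ?S2_gt0. Qed.

Lemma xalgS x0 t w : xalg x0 eta g t.+1 w = x0 +
  pot (theta t w) (S2 t w) (Qs t w) *: argmax_half (theta t w) (S2 t w).
Proof.
rewrite -alg_outE ?S2_gt0// /xalg /theta /S2 /Qs /=.
by case: alg_state => -[].
Qed.

End state.

(** * Measurability of the state *)

Section state_measurability.
Context {R : realType} {d : nat}.

(** The measurable space is a parameter because the notion is used both on the full space and on the
    sigma-algebras of the filtration. *)
Definition state_measurable {dT} {T : measurableType dT} (eta : nat -> T -> R)
    (g : nat -> T -> 'rV[R]_d) t :=
  [/\ vmeasurable (theta eta g t), measurable_fun setT (S2 eta g t)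
    & measurable_fun setT (Qs eta g t)].

Lemma state_measurable0 {dT} {T : measurableType dT} (eta : nat -> T -> R)
  (g : nat -> T -> 'rV[R]_d) : state_measurable eta g 0.
Proof. by split => [i||]; exact: measurable_cst. Qed.

Lemma state_measurableS {dT} {T : measurableType dT} (eta : nat -> T -> R)
    (g : nat -> T -> 'rV[R]_d) t : state_measurable eta g t ->
  measurable_fun setT (eta t.+1) -> vmeasurable (g t.+1) ->
  state_measurable eta g t.+1.
Proof.
move=> [mth mS mQ] meta mg.
have ml : vmeasurable (step eta g t) by exact: vmeasurableZ.
have mll := measurable_dotv ml ml.
have mS' : measurable_fun setT (S2 eta g t.+1).
  have -> : S2 eta g t.+1 = (fun w => S2 eta g t w +
      dotv (step eta g t w) (step eta g t w)) by apply/funext => w; rewrite S2S.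
  exact: measurable_funD.
split=> //.
- have -> : theta eta g t.+1 = (fun w => theta eta g t w - step eta g t w).
    by apply/funext => w; rewrite thetaS.
  exact: vmeasurableB.
- have -> : Qs eta g t.+1 = (fun w => Qs eta g t w +
      dotv (step eta g t w) (step eta g t w) / S2 eta g t.+1 w).
    by apply/funext => w; rewrite QsS.
  apply: measurable_funD => //; apply: measurable_funM => //.
  by apply: measurable_inv_ge0 => // w; exact/ltW/S2_gt0.
Qed.

Lemma vmeasurable_xalg {dT} {T : measurableType dT} (eta : nat -> T -> R)
    (g : nat -> T -> 'rV[R]_d) x0 t : state_measurable eta g t ->
  vmeasurable (xalg x0 eta g t.+1).
Proof.
move=> [mth mS mQ].
have -> : xalg x0 eta g t.+1 =
    (fun w => x0 + alg_out (theta eta g t w) (S2 eta g t w) (Qs eta g t w)).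
  by apply/funext => w; rewrite xalgS alg_outE ?S2_gt0.
apply: vmeasurableD; first exact: vmeasurable_cst.
by apply: vmeasurable_alg_out => // w; exact: S2_gt0.
Qed.

End state_measurability.

(** * The filtration generated by iterates and gradients *)

Section filtration.
Context {R : realType} {d : nat} {dT : measure_display} {T : measurableType dT}.
Variables (x0 : 'rV[R]_d) (eta : nat -> T -> R) (g : nat -> T -> 'rV[R]_d).
Hypothesis mg : forall t, (1 <= t)%N -> vmeasurable (g t).
Hypothesis meta : forall t, (1 <= t)%N -> measurable_wrt (filtr x0 eta g t) (eta t).

Lemma filtr_subS t : filtr x0 eta g t `<=` filtr x0 eta g t.+1.
Proof.
apply: sub_smallest2r; first exact: smallest_sigma_algebra.
move=> A [i [B [mB [s]]]] H; exists i, B; split => //; exists s.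
by case: H => -[/andP[s1 st] ->]; [left|right]; rewrite s1 ltnW.
Qed.

Let F' t := g_sigma_algebraType (gen_sets x0 eta g t).

Lemma g_filtr t i : measurable_wrt (filtr x0 eta g t.+2) (fun w => g t.+1 w ord0 i).
Proof.
move=> B mB; apply: sub_gen_smallest; exists i, B; split=> //.
by exists t.+1; right; rewrite ltnSn.
Qed.

Lemma state_filtr t : @state_measurable R d _ (F' t.+1) eta g t.
Proof.
elim: t => [|t [mth mS mQ]]; first exact: state_measurable0.
have up (f : T -> R) : measurable_fun setT (f : F' t.+1 -> R) ->
    measurable_fun setT (f : F' t.+2 -> R).
  move=> /measurable_wrtE mf; apply/measurable_wrtE => B mB.
  apply: filtr_subS; exact: mf.
apply: (@state_measurableS R d _ (F' t.+2)).
- by split => [i||]; apply: up.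
- by apply: up; apply/measurable_wrtE; exact: meta.
- by move=> i; apply/measurable_wrtE; exact: g_filtr.
Qed.

(** The two claims are proved together: the sigma-algebra of time [t.+1] involves the iterate built
    from state [t], while state [t.+1] involves a learning rate measurable for that
    sigma-algebra. *)
Lemma filtr_measurable t : filtr x0 eta g t `<=` measurable /\
  state_measurable eta g t.
Proof.
elim: t => [|t [IH mst]].
  split; last exact: state_measurable0.
  apply: smallest_sub; first exact: sigma_algebra_measurable.
  move=> A [i [B [mB [s]]]] [[/andP[s1 s2] _]|[/andP[s1 s2] _]].
    by have := leq_trans s1 s2.
  by have := leq_ltn_trans s1 s2.
have Ft : filtr x0 eta g t.+1 `<=` measurable.
  apply: smallest_sub; first exact: sigma_algebra_measurable.
  move=> A [i [B [mB [s]]]] [[/andP[s1 s2] ->]|[/andP[s1 s2] ->]].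
    move: s2; rewrite leq_eqVlt => /predU1P[->|st].
      by rewrite -[_ @^-1` _]setTI; exact: (vmeasurable_xalg x0 mst).
    apply: IH; apply: sub_gen_smallest; exists i, B; split => //.
    by exists s; left; rewrite s1.
  by rewrite -[_ @^-1` _]setTI; exact: mg.
split=> //; apply: state_measurableS => //; last exact: mg.
by apply: (measurable_wrtW Ft); exact: meta.
Qed.

End filtration.

(** * The Lyapunov function: coercivity, descent and vanishing gradient *)

Section lyapunov.
Context {R : realType} {d : nat}.
Implicit Types (th u v : 'rV[R]_d) (S Q c : R).

Definition lyap u th S Q : R := pot th S Q - dotv th u.

(** The exponent is at least [enorm th / 2 - c], and the exponential of [enorm th / 2] is the square
    of one that dominates [enorm th / 4]. Quadratic growth is enough to beat the linear term of
    [lyap]. *)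
Lemma pot_ge_quadratic th S Q c : 0 < S -> S / 4 + Q <= c ->
  expR (- c) / 16 * enorm th ^+ 2 <= pot th S Q.
Proof.
move=> S0 SQc; have h := max_half_lb th S0.
apply: (@le_trans _ _ (expR (- c) * expR (enorm th / 4) ^+ 2)); last first.
  by rewrite -expRM_natr -expRD ler_expR; lra.
rewrite -mulrA ler_pM2l ?expR_gt0//.
have -> : 16^-1 * enorm th ^+ 2 = (enorm th / 4) ^+ 2 by field.
have e0 := enorm_ge0 th; have h1 := expR_ge1Dx (enorm th / 4).
rewrite lerXn2r ?nnegrE ?expR_ge0//; first by rewrite divr_ge0.
by apply: le_trans h1; rewrite lerDr.
Qed.

Lemma lyap_lb u c : exists C, forall th S Q, 0 < S -> S / 4 + Q <= c ->
  - C <= lyap u th S Q.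
Proof.
pose k := expR (- c) / 16; have k0 : 0 < k by rewrite divr_gt0 ?expR_gt0.
exists (enorm u ^+ 2 / (4 * k)) => th S Q S0 SQc; rewrite /lyap.
have h := pot_ge_quadratic th S0 SQc; have := dotv_le th u; rewrite -/k in h.
have : 0 <= (2 * k * enorm th - enorm u) ^+ 2 / (4 * k).
  by rewrite divr_ge0 ?sqr_ge0// mulr_ge0// ltW.
have -> : (2 * k * enorm th - enorm u) ^+ 2 / (4 * k) =
  k * enorm th ^+ 2 - enorm th * enorm u + enorm u ^+ 2 / (4 * k) by field; lra.
lra.
Qed.

Lemma lyap_coercive u c M : exists B, forall th S Q, 0 < S -> S / 4 + Q <= c ->
  lyap u th S Q <= M -> enorm th <= B.
Proof.
pose k := expR (- c) / 16; have k0 : 0 < k by rewrite divr_gt0 ?expR_gt0.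
exists (1 + (`|M| + enorm u) / k) => th S Q S0 SQc; rewrite /lyap => hM.
have h := pot_ge_quadratic th S0 SQc; have := dotv_le th u; rewrite -/k in h.
have M0 := normr_ge0 M; have MM := ler_norm M; have u0 := enorm_ge0 u.
have [t1|/ltW t1] := leP (enorm th) 1.
  by move=> _; apply: le_trans t1 _; rewrite lerDl divr_ge0 ?addr_ge0// ltW.
move=> hd; suff : enorm th <= (`|M| + enorm u) / k by move=> ?; lra.
rewrite ler_pdivlMr// -(ler_pM2r (_ : 0 < enorm th)); last lra.
have : `|M| <= `|M| * enorm th by rewrite ler_peMr.
nra.
Qed.

Lemma lyap_step u th l S Q : 0 < S -> dotv l l <= 1 ->
  lyap u (th - l) (S + dotv l l) (Q + dotv l l / (S + dotv l l)) <=
  lyap u th S Q - dotv l (pot th S Q *: argmax_half th S - u).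
Proof.
move=> S0 l1; have := pot_step th Q S0 l1; rewrite /lyap !dotvE.
lra.
Qed.

Lemma enorm_grad_le th S Q B : 0 < S -> 0 <= Q -> enorm th <= B ->
  enorm (pot th S Q *: argmax_half th S) <= expR (B / 2) / 2.
Proof.
move=> S0 Q0 thB; rewrite enormZ ger0_norm ?(ltW (pot_gt0 _ _ _))//.
apply: ler_pM; rewrite ?enorm_ge0 ?enorm_argmax_half ?(ltW (pot_gt0 _ _ _))//.
by apply: le_trans (pot_le th S0 Q0) _; rewrite ler_expR; lra.
Qed.

(* If the gradient [v_t] did not tend to 0, a gradient step of fixed length from
   [th t] would push [lyap] below the lower bound given by its tangent plane at an
   earlier [th s] with [v_s] small. *)
Lemma grad_cvg0 u B (th : nat -> 'rV[R]_d) (S Q : nat -> R) :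
  (forall t, 4 <= S t) -> (forall t, 0 <= Q t) ->
  nondecreasing_seq S -> nondecreasing_seq Q -> cvgn S -> cvgn Q ->
  (forall t, enorm (th t) <= B) -> cvgn (fun t => lyap u (th t) (S t) (Q t)) ->
  let v t := pot (th t) (S t) (Q t) *: argmax_half (th t) (S t) - u in
  (forall e N, 0 < e -> exists2 t, (N <= t)%N & enorm (v t) <= e) ->
  (fun t => enorm (v t)) @ \oo --> 0.
Proof.
move=> S4 Q0 ndS ndQ cS cQ thB cW v small.
have S0 t : 0 < S t by have := S4 t; lra.
have B0 : 0 <= B := le_trans (enorm_ge0 _) (thB 0%N).
have cauchy (x : nat -> R) e : cvgn x -> 0 < e ->
    exists N, forall s t, (N <= s)%N -> (N <= t)%N -> x t - x s <= e.
  move=> /cvg_ex[l /cvgrPdist_le xl] e0.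
  have e2 : 0 < e / 2 by lra.
  have [N _ hN] := xl _ e2.
  exists N => s t Ns Nt; have /= := hN s Ns; have /= := hN t Nt.
  by rewrite !ler_norml => /andP[? ?] /andP[? ?]; lra.
pose p := expR (B / 2); have p0 : 0 < p := expR_gt0 _.
pose V := p / 2 + enorm u; have V0 : 0 <= V by rewrite addr_ge0 ?enorm_ge0//; lra.
have vV t : enorm (v t) <= V.
  apply: le_trans (ler_enormB _ _) _; rewrite lerD2r.
  exact: enorm_grad_le (thB t).
pose lam := (1 + V + 4 * p)^-1.
have D0 : 0 < 1 + V + 4 * p by lra.
(* The step length [lam] keeps the move [lam *: v t] in the unit ball, and [lam * (4 * p) <= 1] lets
   the quadratic error of [pot_descent] absorb at most half of the gain. *)
have lam0 : 0 < lam by rewrite invr_gt0.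
have lamE : lam * (1 + V + 4 * p) = 1 by rewrite mulVf// gt_eqF.
pose p' := expR ((B + 1) / 2); have p'0 : 0 < p' := expR_gt0 _.
(* Compares two bounds at the same point [y], one gradient step from [th t]: descent from above, the
   tangent plane at [th s] from below. The last term pays for the growth of [S] and [Q] between the
   two times. *)
have main s t : (s <= t)%N -> lam / 2 * enorm (v t) ^+ 2 <=
    (lyap u (th t) (S t) (Q t) - lyap u (th s) (S s) (Q s)) +
    enorm (v s) * (2 * B + 1) + p' * ((S t - S s) / 4 + (Q t - Q s)).
  move=> st; pose l := lam *: v t; pose y := th t - l.
  have v0 := enorm_ge0 (v t).
  have nl : enorm l <= 1.
    rewrite enormZ ger0_norm ?(ltW lam0)//.
    have := vV t; nra.
  have ll : dotv l l <= 1.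
    by rewrite -sqr_enorm expr_le1// enorm_ge0.
  have ny : enorm y <= B + 1.
    by apply: le_trans (ler_enormB _ _) _; apply: lerD.
  have desc := pot_descent (th t) (S4 t) (Q0 t) ll; rewrite -/y in desc.
  have pt : pot (th t) (S t) (Q t) <= p.
    by apply: le_trans (pot_le _ (S0 t) (Q0 t)) _; rewrite ler_expR ler_pM2r.
  have py : pot y (S s) (Q s) <= p'.
    by apply: le_trans (pot_le _ (S0 s) (Q0 s)) _; rewrite ler_expR ler_pM2r.
  have Sst := ndS _ _ st; have Qst := ndQ _ _ st.
  have low := pot_geSQ y (Q s) (Q t) (S0 s) Sst.
  have tang := pot_ge_tangent (th s) y (Q s) (S0 s).
  have cs : - (enorm (v s) * (2 * B + 1)) <= dotv (v s) (y - th s).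
    rewrite lerNl -dotvNl; apply: le_trans (dotv_le _ _) _.
    rewrite enormN ler_wpM2l ?enorm_ge0//.
    apply: le_trans (ler_enormB _ _) _; have := thB s; lra.
  have lv : dotv l (v t) = lam * enorm (v t) ^+ 2 by rewrite dotvZl sqr_enorm.
  have llE : dotv l l = lam ^+ 2 * enorm (v t) ^+ 2.
    by rewrite dotvZl dotvZr sqr_enorm expr2 mulrA.
  set a := enorm (v t) ^+ 2 in lv llE *.
  have a0 : 0 <= a by rewrite exprn_ge0.
  have q1 : 2 * dotv l l * pot (th t) (S t) (Q t) <= lam / 2 * a.
    rewrite llE; apply: (@le_trans _ _ (2 * (lam ^+ 2 * a) * p)).
      by rewrite ler_wpM2l// mulr_ge0// mulr_ge0// exprn_ge0// ltW.
    have -> : 2 * (lam ^+ 2 * a) * p = lam / 2 * a * (lam * (4 * p)) by field.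
    by rewrite ler_piMr ?mulr_ge0//; nra.
  have q2 : pot y (S s) (Q s) * ((S t - S s) / 4 + (Q t - Q s)) <=
      p' * ((S t - S s) / 4 + (Q t - Q s)) by rewrite ler_wpM2r//; lra.
  have X1 : dotv l (pot (th t) (S t) (Q t) *: argmax_half (th t) (S t)) =
      dotv l (v t) + dotv l u by rewrite /v dotvDr dotvNr addrNK.
  have X2 : dotv (pot (th s) (S s) (Q s) *: argmax_half (th s) (S s)) (y - th s) =
      dotv (v s) (y - th s) + (dotv y u - dotv (th s) u).
    by rewrite /v dotvDl dotvNl -(dotvNl (th s)) -dotvDl (dotvC u) addrNK.
  have X3 : dotv y u = dotv (th t) u - dotv l u by rewrite /y dotvDl dotvNl.
  rewrite X1 lv in desc; rewrite X2 in tang; rewrite /lyap.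
  lra.
apply/cvgrPdist_le => /= e e0.
(* Chosen so that the three error terms of [main], each controlled by [e'], add up to exactly
   [lam / 2 * e ^+ 2]. *)
pose e' := lam / 2 * e ^+ 2 / (2 * B + 2 + 2 * p').
have E0 : 0 < 2 * B + 2 + 2 * p' by lra.
have e'0 : 0 < e' by rewrite !divr_gt0 ?mulr_gt0 ?exprn_gt0//.
have [N1 h1] := cauchy _ _ cW e'0.
have [N2 h2] := cauchy _ _ cS e'0.
have [N3 h3] := cauchy _ _ cQ e'0.
have [s sN vs] := small e' (maxn N1 (maxn N2 N3)) e'0.
move: sN; rewrite !geq_max => /and3P[s1 s2 s3].
exists s => // t /= st.
rewrite sub0r normrN ger0_norm ?enorm_ge0//.
rewrite -(@ler_pXn2r _ 2) ?nnegrE ?enorm_ge0 ?(ltW e0)//.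
have l2 : 0 < lam / 2 by lra.
rewrite -(ler_pM2l l2); apply: le_trans (main s t st) _.
have -> : lam / 2 * e ^+ 2 = e' + e' * (2 * B + 1) + p' * (e' + e').
  by rewrite /e'; field; lra.
have a1 := h1 s t s1 (leq_trans s1 st).
have a2 := h2 s t s2 (leq_trans s2 st).
have a3 := h3 s t s3 (leq_trans s3 st).
apply: lerD; first by apply: lerD => //; rewrite ler_wpM2r//; lra.
by rewrite ler_pM2l//; have := ndS _ _ st; lra.
Qed.

End lyapunov.

(** * Recurrence of the iterates near the minimiser *)

Section recurrence.
Context {R : realType} {d : nat}.

Lemma continuous_dotv (f h : 'rV[R]_d -> 'rV[R]_d) :
  continuous f -> continuous h -> continuous (fun x => dotv (f x) (h x)).
Proof.
move=> cf ch x; rewrite /dotv; elim: (index_enum _) => [|i r IH].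
  under eq_fun do rewrite big_nil.
  exact: cst_continuous.
under eq_fun do rewrite big_cons.
have ci (k : 'rV[R]_d -> 'rV[R]_d) : continuous k ->
    (fun y => k y ord0 i) y @[y --> nbhs x] --> k x ord0 i.
  move=> ck; apply: (@continuous_comp _ _ _ k (fun M : 'rV[R]_d => M ord0 i)); first exact: ck.
  exact: coord_continuous.
exact: (cvgD (cvgM (ci _ cf) (ci _ ch)) IH).
Qed.

(** A continuous function attains its minimum on the compact annulus, which avoids [a]. If the
    annulus is empty, any positive [m] works. *)
Lemma positive_on_annulus (q : 'rV[R]_d -> R) (a : 'rV[R]_d) e V :
  continuous q -> (forall x, x != a -> 0 < q x) -> 0 < e ->
  exists2 m, 0 < m & forall x, e <= enorm (x - a) -> enorm (x - a) <= V -> m <= q x.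
Proof.
move=> cq q0 e0.
pose n2 x := dotv (x - a) (x - a).
have cn2 : continuous n2.
  have cB : continuous (fun x : 'rV[R]_d => x - a).
    by move=> x; exact: (cvgB (@cvg_id _ (nbhs x)) (cvg_cst a)).
  exact: (continuous_dotv cB cB).
pose K := [set x | e <= enorm (x - a) /\ enorm (x - a) <= V].
have [K0|K0] := pselect (K !=set0); last first.
  by exists 1 => // x x1 x2; exfalso; apply: K0; exists x.
have V0 : 0 <= V by case: K0 => x [_]; apply: le_trans; exact: enorm_ge0.
have KE : K = n2 @^-1` `[e ^+ 2, V ^+ 2]%classic.
  apply/seteqP; split => x; rewrite /K /n2 /= in_itv /= -sqr_enorm.
    by move=> [h1 h2]; rewrite !lerXn2r ?nnegrE ?enorm_ge0// ltW.
  by rewrite !ler_pXn2r ?nnegrE ?enorm_ge0 ?(ltW e0)// => /andP[].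
have Kc : compact K.
  apply: bounded_closed_compact.
    exists (V + `|a|); split; first exact: num_real.
    move=> r Vr x [_ xV]; apply: le_trans (ltW Vr).
    rewrite -[x](subrK a); apply: le_trans (ler_normD _ _) _; rewrite lerD2r.
    rewrite [leLHS]/Num.norm /= mx_normrE; apply/bigmax_leP; split => //= -[i j] _ /=.
    by rewrite ord1; apply: le_trans (normr_coord_le_enorm _ _) xV.
  rewrite KE; apply: preimage_closed; last exact: itv_closed.
  by move=> x _; exact: cn2.
have [c cK cmin] := compact_EVT_min K0 Kc (continuous_subspaceT cq).
exists (q c).
  apply: q0; apply/eqP => ca; move: cK; rewrite inE => -[]; rewrite ca subrr enorm0; lra.
by move=> x x1 x2; apply: cmin; rewrite inE.
Qed.

(** If the sequence stayed at distance more than [e] after [N], each later term would be at least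
    [m * eta k], so the partial sums of [eta] would be bounded. *)
Lemma recurrent (q : 'rV[R]_d -> R) (a : 'rV[R]_d) (x : nat -> 'rV[R]_d)
    (eta : nat -> R) V M :
  continuous q -> (forall y, y != a -> 0 < q y) -> (forall y, 0 <= q y) ->
  (forall t, enorm (x t - a) <= V) -> (forall t, 0 <= eta t) ->
  (forall n, \sum_(k < n) eta k * q (x k) <= M) ->
  (forall K, exists n, K <= \sum_(k < n) eta k) ->
  forall e N, 0 < e -> exists2 t, (N <= t)%N & enorm (x t - a) <= e.
Proof.
move=> cq qp q0 xV eta0 sM sinf e N e0.
have [m m0 hm] := positive_on_annulus V cq qp e0.
apply: contrapT => h.
have far t : (N <= t)%N -> m <= q (x t).
  move=> Nt; apply: hm => //; rewrite leNgt; apply/negP => lt.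
  by apply: h; exists t => //; exact: ltW.
have bound n : \sum_(k < n) eta k <= \sum_(k < N) eta k + M / m.
  rewrite -lerBlDl ler_pdivlMr// mulrC; apply: le_trans (sM n).
  rewrite -!(big_mkord xpredT) -(big_mkord xpredT (fun k => eta k * q (x k))).
  have [nN|/ltnW Nn] := leqP n N.
    apply: (@le_trans _ _ 0); last by apply: sumr_ge0 => k _; rewrite mulr_ge0.
    rewrite pmulr_rle0// subr_le0 (@big_cat_nat _ _ _ n _ N)//= lerDl.
    exact: sumr_ge0.
  rewrite (@big_cat_nat _ _ _ N _ n)//= addrAC subrr add0r mulr_sumr.
  rewrite [leRHS](@big_cat_nat _ _ _ N _ n)//=.
  apply: ler_wpDl; first by apply: sumr_ge0 => k _; rewrite mulr_ge0.
  rewrite big_nat_cond [leRHS]big_nat_cond; apply: ler_sum => k /andP[/andP[Nk _] _].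
  by rewrite mulrC ler_wpM2l// far.
have [n] := sinf (\sum_(k < N) eta k + M / m + 1).
by have := bound n; lra.
Qed.

End recurrence.

(** * Deterministic bounds along one trajectory *)

Section trajectory.
Context {R : realType} {d : nat} {T : Type}.
Variables (eta : nat -> T -> R) (g : nat -> T -> 'rV[R]_d) (w : T).

Let sq k := dotv (step eta g k w) (step eta g k w).

Lemma S2_sum t : S2 eta g t w = 4 + \sum_(k < t) sq k.
Proof.
elim: t => [|t IH]; first by rewrite big_ord0 addr0.
by rewrite S2S IH big_ord_recr /= addrA.
Qed.

Lemma Qs_sum t : Qs eta g t w <= \sum_(k < t) sq k.
Proof.
elim: t => [|t IH]; first by rewrite big_ord0.
rewrite QsS big_ord_recr /=; apply: lerD => //.
rewrite ler_pdivrMr ?S2_gt0// ler_peMr ?dotv_ge0//.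
by have := S2_ge4 eta g t.+1 w; lra.
Qed.

(** This combination is what the growth bounds on [pot] require. The bound depends only on [gamma],
    so the resulting lower bound on [lyap] is uniform over time and trajectories. *)
Lemma S2_Qs_le gamma t : \sum_(k < t) sq k <= gamma ->
  S2 eta g t w / 4 + Qs eta g t w <= 1 + 2 * gamma.
Proof.
have : 0 <= \sum_(k < t) sq k by apply: sumr_ge0 => k _; exact: dotv_ge0.
by have := Qs_sum t; rewrite S2_sum; lra.
Qed.

(** A crude bound, but nonrandom at each fixed [t], as integrability of the Lyapunov values
    requires. *)
Lemma enorm_theta t : (forall k, enorm (step eta g k w) <= 1) ->
  enorm (theta eta g t w) <= t%:R.
Proof.
move=> s1; elim: t => [|t IH]; first by rewrite /theta /= enorm0.
rewrite thetaS -natr1; apply: le_trans (ler_enormB _ _) _.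
exact: lerD.
Qed.

Lemma enorm_step G t : 0 < G -> 0 <= eta t.+1 w <= G^-1 ->
  enorm (g t.+1 w) <= G -> enorm (step eta g t w) <= 1.
Proof.
move=> G0 /andP[e0 eG] gG; rewrite enormZ ger0_norm//.
rewrite -[leRHS](@mulVf _ G) ?gt_eqF//.
by apply: ler_pM; rewrite ?enorm_ge0.
Qed.

Lemma step_series_le gamma t :
  (\sum_(1 <= t <oo) ((eta t w) ^+ 2 * enorm (g t w) ^+ 2)%:E < gamma%:E)%E ->
  \sum_(k < t) sq k <= gamma.
Proof.
move=> h; rewrite -lee_fin; apply: le_trans (ltW h); rewrite -sumEFin.
have := @nneseries_lim_ge R (fun t => ((eta t w) ^+ 2 * enorm (g t w) ^+ 2)%:E) xpredT 1 t.+1.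
rewrite big_add1 /= big_mkord => /(_ _) H.
apply: le_trans (H _); last first.
  by move=> k _ _; rewrite lee_fin -exprMn sqr_ge0.
by apply: lee_sum => k _; rewrite lee_fin /sq /step dotvZl dotvZr sqr_enorm mulrA expr2.
Qed.

Lemma eta_series_infinite : (forall t, (1 <= t)%N -> 0 <= eta t w) ->
  (\sum_(1 <= t <oo) (eta t w)%:E = +oo)%E ->
  forall K, exists n, K <= \sum_(k < n) eta k.+1 w.
Proof.
move=> e0 h K; apply: contrapT => nK.
have le n : \sum_(k < n) eta k.+1 w <= K.
  by rewrite leNgt; apply/negP => lt; apply: nK; exists n; exact: ltW.
suff : (\sum_(1 <= t <oo) (eta t w)%:E <= K%:E)%E by rewrite h leye_eq.
apply: lime_le.
  by apply: is_cvg_ereal_nneg_natsum => k k1; rewrite lee_fin e0.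
near=> n; have n1 : (1 <= n)%N by near: n; exists 1%N.
rewrite -(prednK n1) big_add1 /= big_mkord sumEFin lee_fin; exact: le.
Unshelve. all: by end_near. Qed.

End trajectory.

(** * The stochastic argument and convergence of the iterates *)

Section convergence.
Context {R : realType} {d : nat} {dT : measure_display} {T : measurableType dT}
  (P : probability T R).
Variables (F : 'rV[R]_d -> R) (xstar : 'rV[R]_d) (G gamma : R) (x0 : 'rV[R]_d)
  (g : nat -> T -> 'rV[R]_d) (eta : nat -> T -> R).
Hypothesis G0 : 0 < G.
Hypothesis cohF : variationally_coherent F xstar.
Hypothesis mg : forall t, (1 <= t)%N -> vmeasurable (g t).
Hypothesis condg : forall t, (1 <= t)%N ->
  is_cond_exp P (filtr x0 eta g t) (g t) (fun w => grad F (xalg x0 eta g t w)).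
Hypothesis eta0 : forall t w, (1 <= t)%N -> 0 <= eta t w.
Hypothesis meta : forall t, (1 <= t)%N -> measurable_wrt (filtr x0 eta g t) (eta t).
Hypothesis gG : {ae P, forall w, forall t, enorm (g t.+1 w) <= G}.
Hypothesis good : {ae P, forall w,
  [/\ (\sum_(1 <= t <oo) ((eta t w) ^+ 2 * enorm (g t w) ^+ 2)%:E < gamma%:E)%E,
      (\sum_(1 <= t <oo) (eta t w)%:E = +oo)%E
    & forall t, (1 <= t)%N -> eta t w <= G^-1]}.

Let u := xstar - x0.
(** Indices are shifted: [X t] is the iterate computed from state [t], and [gs t] generates the
    sigma-algebra of time [t.+1], for which that state is measurable. *)
Let X t w := xalg x0 eta g t.+1 w.
Let gs t := gen_sets x0 eta g t.+1.
Let W t w := lyap u (theta eta g t w) (S2 eta g t w) (Qs eta g t w).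
Let q x := dotv (grad F x) (x - xstar).
Let D t w := eta t.+1 w * q (X t w).
Let Z t w := dotv (step eta g t w) (X t w - xstar).

Let XE t w : X t w - xstar = pot (theta eta g t w) (S2 eta g t w) (Qs eta g t w) *:
    argmax_half (theta eta g t w) (S2 eta g t w) - u.
Proof. by rewrite /X xalgS /u opprB [RHS]addrCA addrA. Qed.

Let Gsub t : <<s gs t >> `<=` measurable.
Proof. exact: (filtr_measurable mg meta t.+1).1. Qed.

Let q_ge0 x : 0 <= q x.
Proof. by have [_ _ _ _ /(_ x)[]] := cohF. Qed.

Let D_ge0 t w : 0 <= D t w.
Proof. by rewrite mulr_ge0// eta0. Qed.

Let step_le1 : {ae P, forall w, forall t, enorm (step eta g t w) <= 1}.
Proof.
apply: filterS2 gG good => w gGw [_ _ etaG] t.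
by apply: (@enorm_step R d T eta g w G) => //; rewrite eta0//= etaG.
Qed.

Let mW t : measurable_wrt <<s gs t >> (W t).
Proof.
have [mth mS mQ] := state_filtr meta t.
apply/measurable_wrtE; apply: measurable_funB.
  by apply: measurable_pot => // w; exact: S2_gt0.
by apply: measurable_dotv => //; exact: vmeasurable_cst.
Qed.

Let mX t : @vmeasurable R d _ (g_sigma_algebraType (gs t)) (X t).
Proof. exact: (vmeasurable_xalg x0 (state_filtr meta t)). Qed.

Let bound t : R := expR (t%:R / 2) + enorm u.

Let normX t w : enorm (theta eta g t w) <= t%:R -> enorm (X t w - xstar) <= bound t.
Proof.
move=> th; rewrite XE; apply: le_trans (ler_enormB _ _) _; rewrite lerD2r.
apply: le_trans (enorm_grad_le (S2_gt0 _ _ _ _) (Qs_ge0 _ _ _ _) th) _.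
by have := expR_gt0 (t%:R / 2 : R); lra.
Qed.

Let intW t : P.-integrable setT (EFin \o W t).
Proof.
apply: (@ae_bounded_integrable _ _ _ P _ (expR (t%:R / 2) + t%:R * enorm u)).
  exact: measurable_wrtW (@Gsub t) (@mW t).
apply: filterS step_le1 => w /(enorm_theta t) th.
apply: le_trans (ler_normB _ _) _; apply: lerD.
  rewrite ger0_norm ?(ltW (pot_gt0 _ _ _))//.
  apply: le_trans (pot_le _ (S2_gt0 _ _ _ _) (Qs_ge0 _ _ _ _)) _.
  by rewrite ler_expR ler_pM2r.
by apply: le_trans (normr_dotv_le _ _) _; rewrite ler_wpM2r ?enorm_ge0.
Qed.

(** The coefficient of coordinate [i] of the stochastic gradient in [Z t]. It is known before the
    gradient arrives and can be pulled out of the conditional expectation. *)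
Let h t i w := eta t.+1 w * (X t w - xstar) ord0 i.

Let mh t i : measurable_wrt <<s gs t >> (h t i).
Proof.
apply/measurable_wrtE.
apply: (@measurable_funM _ (g_sigma_algebraType (gs t))).
  by apply/measurable_wrtE; exact: meta.
apply: vmeasurableB; first exact: mX.
exact: vmeasurable_cst.
Qed.

Let hbound t i : {ae P, forall w, `|h t i w| <= G^-1 * bound t}.
Proof.
apply: filterS2 step_le1 good => w /(enorm_theta t) th [_ _ etaG].
rewrite normrM; apply: ler_pM => //; first by rewrite ger0_norm ?eta0 ?etaG.
by apply: le_trans (normr_coord_le_enorm _ _) _; exact: normX.
Qed.

Let Y t w := grad F (X t w).

Let inth t i (Q : T -> 'rV[R]_d) : P.-integrable setT (fun w => (Q w ord0 i)%:E) ->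
  P.-integrable setT (EFin \o (fun w => h t i w * Q w ord0 i)).
Proof.
move=> iQ; apply: (@ae_bounded_integrableM _ _ _ P _ (fun w => Q w ord0 i) _ _ (hbound t i) iQ).
exact: measurable_wrtW (@Gsub t) (@mh t i).
Qed.

Let ZE t : Z t = fun w => \sum_(i < d) h t i w * g t.+1 w ord0 i.
Proof.
apply/funext => w; rewrite /Z /step dotvZl mulr_sumr; apply: eq_bigr => i _.
by rewrite /h; ring.
Qed.

Let DE t : D t = fun w => \sum_(i < d) h t i w * Y t w ord0 i.
Proof.
apply/funext => w; rewrite /D /q /dotv mulr_sumr; apply: eq_bigr => i _.
by rewrite /h /Y; ring.
Qed.

Let int_g t i : P.-integrable setT (fun w => (g t.+1 w ord0 i)%:E).
Proof. by have [] := @condg t.+1 isT i. Qed.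

Let int_Y t i : P.-integrable setT (fun w => (Y t w ord0 i)%:E).
Proof. by have [] := @condg t.+1 isT i. Qed.

Let intZ t : P.-integrable setT (EFin \o Z t).
Proof. by rewrite ZE; apply: integrable_bigsum => i; apply: inth; exact: int_g. Qed.

Let intD t : P.-integrable setT (EFin \o D t).
Proof. by rewrite DE; apply: integrable_bigsum => i; apply: inth; exact: int_Y. Qed.

Let indic_bound A : {ae P, forall w, `|\1_A w : R| <= 1}.
Proof. by apply: aeW => w; rewrite indicE ger0_norm// lern1 leq_b1. Qed.

Let int_indic t A f : <<s gs t >> A -> P.-integrable setT (EFin \o f) ->
  P.-integrable setT (EFin \o (fun w => \1_A w * f w)).
Proof.
move=> GA intf; apply: (@ae_bounded_integrableM _ _ _ P \1_A f 1) => //.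
by apply: measurable_indic; exact: Gsub GA.
Qed.

(** [D t] is the conditional expectation of [Z t]: the pull-out property is applied in each
    coordinate, with the indicator of [A] times [h t i] as known factor. *)
Let Rintegral_ZD t A : <<s gs t >> A -> \int[P]_(w in A) Z t w = \int[P]_(w in A) D t w.
Proof.
move=> GA; rewrite (Rintegral_indic P A (Z t)) (Rintegral_indic P A (D t)) ZE DE.
under eq_Rintegral do rewrite mulr_sumr.
under [RHS]eq_Rintegral do rewrite mulr_sumr.
rewrite !Rintegral_bigsum; first last.
- by move=> i; apply: (int_indic GA); apply: inth; exact: int_g.
- by move=> i; apply: (int_indic GA); apply: inth; exact: int_Y.
apply: eq_bigr => i _.
under eq_Rintegral do rewrite mulrA.
under [RHS]eq_Rintegral do rewrite mulrA.
apply: (@cond_exp_pull_out _ _ _ P (gs t) _ _ (fun w => \1_A w * h t i w)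
  (G^-1 * bound t) (@Gsub t) (int_g t i) (int_Y t i)).
- by move=> B GB; rewrite /Rintegral; have [_ _ _ ->] := @condg t.+1 isT i.
- apply/measurable_wrtE.
  apply: (@measurable_funM _ (g_sigma_algebraType (gs t))); last exact/measurable_wrtE.
  exact: (@measurable_indic _ (g_sigma_algebraType (gs t))).
- apply: filterS2 (indic_bound A) (hbound t i) => w h1 h2.
  by rewrite normrM -[leRHS]mul1r ler_pM.
Qed.

Let lyap_descent t A : <<s gs t >> A ->
  \int[P]_(w in A) W t.+1 w <= \int[P]_(w in A) W t w - \int[P]_(w in A) D t w.
Proof.
move=> GA; rewrite -(Rintegral_ZD GA) (Rintegral_indic P A (W t.+1)).
rewrite (Rintegral_indic P A (W t)) (Rintegral_indic P A (Z t)).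
rewrite -RintegralB//; [|exact: (int_indic GA)|exact: (int_indic GA)].
apply: ae_le_Rintegral.
- exact: (int_indic GA).
- by apply: integrable_sub; exact: (int_indic GA).
- apply: filterS step_le1 => w /(_ t) s1; rewrite -mulrBr ler_wpM2l ?indicE ?ler0n//.
  have s2 : dotv (step eta g t w) (step eta g t w) <= 1.
    by rewrite -sqr_enorm expr_le1// enorm_ge0.
  have := lyap_step u (theta eta g t w) (Qs eta g t w) (S2_gt0 eta g t w) s2.
  by rewrite -XE -thetaS -S2S -QsS.
Qed.

Let W_lb : exists C, {ae P, forall w, forall t, - C <= W t w}.
Proof.
have [C hC] := lyap_lb u (1 + 2 * gamma); exists C.
apply: filterS good => w [sg _ _] t; apply: hC; first exact: S2_gt0.
exact/S2_Qs_le/step_series_le.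
Qed.

Let W_cvg : {ae P, forall w, cvgn (W ^~ w)}.
Proof.
have [C hC] := W_lb.
apply: (supermartingale_cvg (@Gsub) _ (@mW) intW hC).
- by move=> t; exact: filtr_subS.
- move=> t A GA; apply: le_trans (lyap_descent GA) _.
  by rewrite gerBl; apply: Rintegral_ge0.
Qed.

(** Descent integrated over the whole space telescopes, and the lower bound on [W] then bounds the
    expected partial sums. *)
Let D_summable : {ae P, forall w, exists M, forall n, \sum_(k < n) D k w <= M}.
Proof.
have [C hC] := W_lb.
apply: (@ae_bounded_series _ _ _ P D (\int[P]_w W 0 w + C)) => // n.
have tel : \sum_(k < n) \int[P]_w D k w <= \int[P]_w W 0 w - \int[P]_w W n w.
  elim: n => [|n IH]; first by rewrite big_ord0 subrr.
  rewrite big_ord_recr /=.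
  have := @lyap_descent n setT (@measurableT _ (g_sigma_algebraType (gs n))).
  lra.
suff : - C <= \int[P]_w W n w by lra.
have <- : \int[P]_w (- C) = - C.
  by rewrite Rintegral_cst//= probability_setT mulr1.
apply: ae_le_Rintegral => //; first exact: finite_measure_integrable_cst.
by apply: filterS hC => w.
Qed.

Lemma iterates_cvg :
  {ae P, forall w, (fun t => enorm (xalg x0 eta g t w - xstar)) @ \oo --> 0}.
Proof.
apply: filterS3 W_cvg D_summable good => w Ww [M DM] [sg einf _].
have sqg t := step_series_le t sg.
(* A convergent [W] is bounded above, and sublevel sets of [lyap] are bounded in [th], uniformly in
   the other two state variables. *)
have [B hB] : exists B, forall t, enorm (theta eta g t w) <= B.
  have [K hK] : exists K, forall t, W t w <= K.
    have [K [_ hK]] := cvg_seq_bounded Ww.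
    exists (K + 1) => t; apply: le_trans (ler_norm _) _.
    by apply: hK => //; rewrite ltrDl.
  have [B hB] := lyap_coercive u (1 + 2 * gamma) K.
  by exists B => t; apply: hB (hK t); [exact: S2_gt0|exact: S2_Qs_le].
have ndS : nondecreasing_seq (fun t => S2 eta g t w).
  by apply/nondecreasing_seqP => t; exact: S2_le.
have ndQ : nondecreasing_seq (fun t => Qs eta g t w).
  by apply/nondecreasing_seqP => t; exact: Qs_le.
have cS : cvgn (fun t => S2 eta g t w).
  apply: nondecreasing_is_cvgn => //; exists (4 + gamma) => _ [t _ <-].
  by rewrite S2_sum lerD2l.
have cQ : cvgn (fun t => Qs eta g t w).
  apply: nondecreasing_is_cvgn => //; exists gamma => _ [t _ <-].
  exact: le_trans (Qs_sum _ _ _ _) _.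
have [_ cgrad _ _ coh] := cohF.
have cq : continuous q.
  apply: continuous_dotv => // x.
  exact: (cvgB (@cvg_id _ (nbhs x)) (cvg_cst xstar)).
have qp y : y != xstar -> 0 < q y.
  move=> yx; rewrite lt_neqAle q_ge0 andbT eq_sym; apply/eqP => q0.
  by move/eqP: yx; apply; apply: (coh y).2.1.
have XV t : enorm (X t w - xstar) <= expR (B / 2) / 2 + enorm u.
  rewrite XE; apply: le_trans (ler_enormB _ _) _; rewrite lerD2r.
  exact: enorm_grad_le (S2_gt0 _ _ _ _) (Qs_ge0 _ _ _ _) (hB t).
have rec := recurrent cq qp q_ge0 XV (fun t => eta0 w (ltn0Sn t)) DM
  (eta_series_infinite (eta0^~ w) einf).
(* After the shift the iterate is [X t], whose difference from [xstar] is the Lyapunov gradient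
   treated by [grad_cvg0]. *)
rewrite -(cvg_shiftS (fun t => enorm (xalg x0 eta g t w - xstar))).
under eq_cvg do rewrite /= XE.
apply: (grad_cvg0 (fun t => S2_ge4 eta g t w) (fun t => Qs_ge0 eta g t w)
  ndS ndQ cS cQ hB Ww) => e N e0.
by have [t Nt] := rec e N e0; rewrite XE; exists t.
Qed.

End convergence.

Unset Implicit Arguments.
Set Strict Implicit.

Theorem theorem1 (R : realType) (d : nat) (dT : measure_display)
  (T : measurableType dT) (P : probability T R)
  (F : 'rV[R]_d -> R) (xstar : 'rV[R]_d) (G gamma : R) (x0 : 'rV[R]_d)
  (g : nat -> T -> 'rV[R]_d) (eta : nat -> T -> R) :
  0 < G ->
  variationally_coherent F xstar ->
  (forall t, (1 <= t)%N -> forall i : 'I_d,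
      measurable_fun setT (fun w => g t w ord0 i)) ->
  (forall t, (1 <= t)%N ->
      is_cond_exp P (filtr x0 eta g t) (g t)
        (fun w => grad F (xalg x0 eta g t w))) ->
  (forall t, (1 <= t)%N -> {ae P, forall w, enorm (g t w) <= G}) ->
  (forall t w, (1 <= t)%N -> 0 <= eta t w) ->
  (forall t, (1 <= t)%N -> measurable_wrt (filtr x0 eta g t) (eta t)) ->
  0 < gamma ->
  {ae P, forall w,
      [/\ (\sum_(1 <= t <oo) ((eta t w) ^+ 2 * enorm (g t w) ^+ 2)%:E
             < gamma%:E)%E,
          (\sum_(1 <= t <oo) (eta t w)%:E = +oo)%E
        & forall t, (1 <= t)%N -> eta t w <= G^-1]} ->
  {ae P, forall w, (fun t => enorm (xalg x0 eta g t w - xstar)) @ \oo --> 0}.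
Proof.
move=> G0 cohF mg condg gG eta0 meta _ good.
apply: (iterates_cvg G0 cohF mg condg eta0 meta _ good).
(* The countably many almost sure bounds on the gradients are merged into one event. *)
by apply: ae_foralln => t; exact: gG.
Qed.
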